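(* Let $G$ be a finite unweighted digraph without loops, with adjacency matrix $A$ and directed deformed graph Laplacian $M(t)=I-At+(D-I)t^2+(A-S)t^3$. Let $\mu$, with $0<\mu\le 1$, be the smallest positive real eigenvalue of $M(t)$, and let $r$ be the radius of convergence of the power series $\sum_{k=0}^\infty t^k p_k(A)$ (which equals $(1-t^2)M(t)^{-1}$ near $t=0$). Let $G_1,\dots,G_s$ be the strongly connected or single node components of $G$ and $H_1,\dots,H_s$ their undirectizations. Then: (a) if every $H_i$ is a tree or an isolated node, then $1=\mu<r=\infty$; (b) if no $H_i$ has more than one cycle but at least one $H_i$ has exactly one cycle, then $1=\mu=r$; (c) if at least one $H_i$ has more than one cycle, then $1>\mu=r$.
   Context: A digraph $G=(V,E)$ has vertex set $V=\{1,\dots,n\}$ and edge set $E\subseteq V\times V$ of ordered pairs (no multiple edges, no loops $(i,i)$). Its adjacency matrix $A$ has $A_{ij}=1$ if $(i,j)\in E$ and $0$ otherwise. $S=A\circ A^T$ (entrywise product) and $D=\mathrm{diag}(\mathrm{diag}(A^2))$, i.e. $D_{ii}$ is the number of $j$ with both $(i,j),(j,i)\in E$. A walk of length $k$ is a sequence of vertices $(v_1,\dots,v_{k+1})$ with $(v_r,v_{r+1})\in E$ for all $r$; it is non-backtracking (NBTW) if $v_{r+2}\neq v_r$ for all $r$. $p_k(A)$ is the $n\times n$ matrix whose $(i,j)$ entry is the number of NBTWs of length $k$ from $i$ to $j$ ($p_0(A)=I$). A finite eigenvalue of a square polynomial matrix $M(t)$ with $\det M(t)\not\equiv 0$ is a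 root of $\det M(t)$. The undirectization of $G$ is the undirected simple graph on $V$ with an edge $\{i,j\}$ whenever $(i,j)\in E$ or $(j,i)\in E$. The strongly connected or single node components of $G$ are the induced subgraphs on the equivalence classes of the relation ''$i=j$, or there are directed walks from $i$ to $j$ and from $j$ to $i$''. A cycle in an undirected graph is a closed path (distinct vertices except first=last) of length $\ge 3$, up to cyclic permutations and reversal. *)

(* Defs.v *)
From HB Require Import structures.
From mathcomp Require Import all_boot all_order all_algebra.
From mathcomp Require Import all_classical all_reals all_analysis.
Set Implicit Arguments. Unset Strict Implicit. Unset Printing Implicit Defensive.
Import Order.TTheory GRing.Theory Num.Theory numFieldNormedType.Exports.
Local Open Scope ring_scope.

(* A digraph on vertex set 'I_n is an edge relation E : rel 'I_n
   (irreflexivity = no loops is a hypothesis of the theorem). *)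

Section DG.
Variables (R : realType) (n : nat) (E : rel 'I_n).

Definition adj : 'M[R]_n := \matrix_(i, j) (E i j)%:R.
Definition symp : 'M[R]_n := \matrix_(i, j) (adj i j * adj j i).
Definition degD : 'M[R]_n := \matrix_(i, j) ((i == j)%:R * (adj *m adj) i i).

Definition deformed_laplacian : 'M[{poly R}]_n :=
  \matrix_(i, j) ( ((i == j)%:R)%:P - (adj i j)%:P * 'X
                 + ((degD i j) - (i == j)%:R)%:P * 'X^2
                 + ((adj i j) - (symp i j))%:P * 'X^3 ).

Definition finite_eigenvalue (t : R) : bool := root (\det deformed_laplacian) t.

Definition is_walk (s : seq 'I_n) : bool :=
  if s is x :: s' then path E x s' else false.

Fixpoint nonbacktracking (s : seq 'I_n) : bool :=
  match s with
  | x :: ((y :: z :: _) as s') => (z != x) && nonbacktracking s'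
  | _ => true
  end.

Definition nbtw_count (k : nat) (i j : 'I_n) : nat :=
  #|[pred w : k.+1.-tuple 'I_n |
      [&& thead w == i, last (thead w) (behead w) == j,
          is_walk w & nonbacktracking w]]|.

Definition pk (k : nat) : 'M[R]_n := \matrix_(i, j) (nbtw_count k i j)%:R.

Definition nbtw_radius : \bar R :=
  ereal_sup [set (rho%:E)%E | rho in
    [set rho : R | 0 <= rho /\
       forall i j : 'I_n, cvgn (series (fun k => pk k i j * rho ^+ k))]].

Definition scomp (x : 'I_n) : {set 'I_n} :=
  [set y | (y == x) || (connect E x y && connect E y x)].

Definition uadj (C : {set 'I_n}) : rel 'I_n :=
  fun u v => [&& u \in C, v \in C & E u v || E v u].

Definition is_ucycle (C : {set 'I_n}) (s : seq 'I_n) : bool :=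
  [&& (3 <= size s)%N, uniq s, all (mem C) s & cycle (uadj C) s].

Definition same_cycle (s t : seq 'I_n) : Prop :=
  exists k, t = rot k s \/ t = rot k (rev s).

Definition acyclic_on (C : {set 'I_n}) : Prop :=
  forall s, ~~ is_ucycle C s.

Definition uconnected_on (C : {set 'I_n}) : Prop :=
  forall u v, u \in C -> v \in C -> connect (uadj C) u v.

Definition is_tree_on (C : {set 'I_n}) : Prop :=
  uconnected_on C /\ acyclic_on C.

Definition isolated_node_on (C : {set 'I_n}) : Prop := #|C| = 1%N.

Definition at_most_one_cycle (C : {set 'I_n}) : Prop :=
  forall s t, is_ucycle C s -> is_ucycle C t -> same_cycle s t.

Definition exactly_one_cycle (C : {set 'I_n}) : Prop :=
  (exists s, is_ucycle C s) /\ at_most_one_cycle C.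

Definition more_than_one_cycle (C : {set 'I_n}) : Prop :=
  exists s t, [/\ is_ucycle C s, is_ucycle C t & ~ same_cycle s t].

End DG.

(* Main.v *)
Require Import Defs.
From HB Require Import structures.
From mathcomp Require Import all_boot all_order all_algebra.
From mathcomp Require Import all_classical all_reals all_analysis.
From mathcomp Require Import ring lra.
From mathcomp Require polyrcf.
Set Implicit Arguments. Unset Strict Implicit. Unset Printing Implicit Defensive.
Import Order.TTheory GRing.Theory Num.Theory numFieldNormedType.Exports.
Local Open Scope ring_scope.

(* Let p_k count the non-backtracking walks of length k. Splitting walks at their
   first step gives M(t) * sum_k t^k p_k = (1 - t^2) I wherever the series converges,
   so M(t) is invertible there unless t = 1, while M(1) = D - S is a Laplacian and is
   singular. Conversely, if M(r) is invertible and the series converges on [0, r),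
   Cramer's rule bounds its partial sums at r, so it converges at r; and
   p_(k+l) <= p_k p_l makes convergence an open condition on the right. Hence
   mu = min (1, radius).

   The radius is read off the graph whose vertices are the arcs and whose edges
   (u,v) -> (v,w), w <> u, are the non-backtracking steps. The first repeated vertex of
   a non-backtracking walk closes an undirected cycle inside a strong component. So
   without cycles walks have bounded length. If each strong component has at most one
   cycle, no arc lies on two different closed walks, and the growth is subexponential.
   Conversely, take two cycles of a strong component and a minimal set of arcs that
   retains them and connects all their vertices. Either its arc graph has a terminal
   component with a branching, which forces exponential growth, or that component is a
   circuit passing through all these vertices, which leaves each of them at most two
   neighbours, and the two cycles coincide. *)

(** * Counting non-backtracking walks *)

Section Counting.
Variables (n : nat) (E : rel 'I_n).
Local Open Scope nat_scope.

(** Only the second arc must be an edge. The first records the vertex that the step must avoid, so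
    that [nbext k (u, v) j] makes sense for every [u]. *)
Definition nbstep : rel ('I_n * 'I_n) :=
  fun e f => [&& E f.1 f.2, f.1 == e.2 & f.2 != e.1].

Fixpoint nbext (k : nat) (e : 'I_n * 'I_n) (j : 'I_n) : nat :=
  if k is k'.+1 then \sum_(f | nbstep e f) nbext k' f j else (e.2 == j : nat).

Lemma card_tuple_cons (T : finType) (k : nat) (P : pred (seq T)) :
  #|[pred w : k.+1.-tuple T | P w]| =
  \sum_(y : T) #|[pred w : k.-tuple T | P (y :: w)]|.
Proof.
rewrite -sum1_card (reindex (fun p : T * k.-tuple T => cons_tuple p.1 p.2)) /=.
  rewrite -(pair_big_dep xpredT (fun y (w : k.-tuple T) => P (y :: w))
     (fun _ _ => 1)) /=.
  by apply: eq_bigr => y _; rewrite sum1_card.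
exists (fun w : k.+1.-tuple T => (thead w, behead_tuple w)) => w _ /=.
  by case: w => y w; congr pair; apply: val_inj.
by rewrite [RHS]tuple_eta; apply: val_inj.
Qed.

Lemma sum_nbstep (u v : 'I_n) (F : 'I_n * 'I_n -> nat) :
  \sum_(f | nbstep (u, v) f) F f = \sum_(y | E v y && (y != u)) F (v, y).
Proof.
transitivity (\sum_(f : 'I_n * 'I_n | (f.1 == v) && (E f.1 f.2 && (f.2 != u)))
                F (f.1, f.2)).
  apply: eq_big => [[x y]|[x y] //]; rewrite /nbstep /=.
  by case: (E x y); case: (x == v).
rewrite -(pair_big_dep (pred1 v) (fun x y => E x y && (y != u)) (fun x y => F (x, y))) /=.
by rewrite big_pred1_eq.
Qed.

Lemma nbextE k (u v j : 'I_n) : nbext k (u, v) j =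
  #|[pred w : k.-tuple 'I_n |
     [&& path E v w, nonbacktracking (u :: v :: w) & last v w == j]]|.
Proof.
elim: k u v => [|k IHk] u v.
  rewrite /= (eq_card (B := [pred w : 0.-tuple 'I_n | v == j])); last first.
    by move=> w; rewrite (tuple0 w) !inE.
  case: (v == j); first by rewrite eq_cardT // -cardE card_tuple expn0.
  by rewrite eq_card0.
rewrite [LHS]/= sum_nbstep (card_tuple_cons k (fun w =>
  [&& path E v w, nonbacktracking [:: u, v & w] & last v w == j])).
rewrite big_mkcond /=; apply: eq_bigr => y _.
have [/andP[Evy yu]|] := boolP (E v y && (y != u)).
  by rewrite IHk; apply: eq_card => w; rewrite !inE Evy yu.
by rewrite negb_and => h; rewrite eq_card0 // => w; rewrite !inE;
  case/orP: h => /negbTE ->; rewrite //= andbF.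
Qed.

Lemma nbtw_countE k (i j : 'I_n) : nbtw_count E k i j =
  #|[pred w : k.-tuple 'I_n |
     [&& path E i w, nonbacktracking (i :: w) & last i w == j]]|.
Proof.
rewrite /nbtw_count (eq_card (B := [pred w : k.+1.-tuple 'I_n |
  (fun s => if s is x :: s' then
     [&& x == i, path E x s', nonbacktracking s & last x s' == j] else false) w])).
  rewrite (card_tuple_cons k (fun s => if s is x :: s' then
     [&& x == i, path E x s', nonbacktracking s & last x s' == j] else false)).
  rewrite (bigD1 i) //= big1 => [|y /negbTE yi].
    by rewrite addn0; apply: eq_card => w; rewrite !inE eqxx.
  by rewrite eq_card0 // => w; rewrite !inE yi.
move=> w; case/tupleP: w => x w; rewrite !inE /= theadE.
by case: (x == i); rewrite //= andbC -andbA.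
Qed.

Lemma nbtw_count0 (i j : 'I_n) : nbtw_count E 0 i j = (i == j).
Proof.
rewrite nbtw_countE (eq_card (B := [pred w : 0.-tuple 'I_n | i == j])); last first.
  by move=> w; rewrite (tuple0 w) !inE.
case: (i == j); first by rewrite eq_cardT // -cardE card_tuple expn0.
by rewrite eq_card0.
Qed.

Lemma nbtw_countS k (i j : 'I_n) :
  nbtw_count E k.+1 i j = \sum_(y | E i y) nbext k (i, y) j.
Proof.
rewrite nbtw_countE (card_tuple_cons k (fun w =>
  [&& path E i w, nonbacktracking (i :: w) & last i w == j])).
rewrite [RHS]big_mkcond /=; apply: eq_bigr => y _.
case Eiy: (E i y); last by rewrite eq_card0 // => w; rewrite !inE.
by rewrite nbextE; apply: eq_card => w; rewrite !inE.
Qed.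

(* Continuations that start by stepping back to [u] are what [nbext] forbids. *)
Lemma nbtw_count_split k (u v j : 'I_n) :
  nbtw_count E k.+1 v j = nbext k.+1 (u, v) j + E v u * nbext k (v, u) j.
Proof.
rewrite nbtw_countS [nbext _ _ _]/= sum_nbstep.
case Evu: (E v u); last first.
  rewrite mul0n addn0; apply: eq_bigl => y.
  by case: eqP => [->|]; rewrite ?Evu ?andbT.
by rewrite (bigD1 u) //= mul1n addnC.
Qed.

Lemma nbext_le_count k (u v j : 'I_n) : nbext k (u, v) j <= nbtw_count E k v j.
Proof.
case: k => [|k]; first by rewrite nbtw_count0.
by rewrite (nbtw_count_split k u) leq_addr.
Qed.

(** Forgetting the non-backtracking condition at the place where a walk is cut can only enlarge the
    count. *)
Lemma nbext_submul k l e (j : 'I_n) :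
  nbext (k + l) e j <= \sum_x nbext k e x * nbtw_count E l x j.
Proof.
elim: k e => [|k IHk] e /=.
  rewrite add0n (bigD1 e.2) //= eqxx mul1n; case: e => u v /=.
  exact: leq_trans (nbext_le_count _ _ _ _) (leq_addr _ _).
under [X in _ <= X]eq_bigr do rewrite big_distrl /=.
rewrite exchange_big /=; apply: leq_sum => f _; exact: IHk.
Qed.

Lemma nbtw_count_submul k l (i j : 'I_n) :
  nbtw_count E (k + l) i j <= \sum_x nbtw_count E k i x * nbtw_count E l x j.
Proof.
case: k => [|k].
  by rewrite add0n (bigD1 i) //= nbtw_count0 eqxx mul1n leq_addr.
rewrite addSn nbtw_countS.
under [X in _ <= X]eq_bigr do rewrite nbtw_countS big_distrl /=.
by rewrite exchange_big /=; apply: leq_sum => f _; apply: nbext_submul.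
Qed.

End Counting.

(** * First repetitions and comparison of cyclic sequences *)

Section CycleSeq.
Local Open Scope nat_scope.

Lemma first_repetition (T : eqType) (s : seq T) : ~~ uniq s ->
  exists s1 y z s2, s = s1 ++ (y :: z) ++ y :: s2 /\ uniq (s1 ++ y :: z).
Proof.
elim/last_ind: s => [//|s x IHs]; rewrite rcons_uniq negb_and negbK.
have [us|/IHs[s1 [y [z [s2 [-> u]]]]] _] := boolP (uniq s); last first.
  by exists s1, y, z, (rcons s2 x); rewrite rcons_cat /= rcons_cat.
rewrite orbF => xs; case/splitPr: xs us => s1 z us.
by exists s1, x, z, [::]; rewrite -cats1 -catA.
Qed.

Lemma iter_next_neq (T : eqType) (s : seq T) x :
  2 < size s -> uniq s -> x \in s -> next s (next s x) != x.
Proof.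
move=> ss us /rot_to[i q def_s]; rewrite -!(next_rot i us) def_s.
have := us; have := ss; rewrite -(size_rot i) -(rot_uniq i) def_s.
case: q {def_s} => [|a [|b q]] //= _ /andP[]; rewrite !inE !negb_or eqxx.
by move=> /and3P[xa xb _] /andP[_ _]; rewrite [a == x]eq_sym (negbTE xa) eqxx eq_sym.
Qed.

Lemma next_neq_prev (T : eqType) (s : seq T) x :
  2 < size s -> uniq s -> x \in s -> next s x != prev s x.
Proof.
move=> ss us xs; apply: contra (iter_next_neq ss us xs) => /eqP ->.
by rewrite next_prev.
Qed.

(** If [t] switched from [next s] to [prev s], it would return to a vertex after two steps, against
    [iter_next_neq]. So both successor maps have the same orbit from [b], and this orbit is a
    rotation of either sequence. *)
Lemma rot_eq_of_next (T : finType) (s t : seq T) b :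
  2 < size t -> uniq s -> uniq t -> b \in s -> b \in t ->
  (forall a, a \in t -> next t a = next s a \/ next t a = prev s a) ->
  next t b = next s b -> exists k, t = rot k s.
Proof.
move=> st us ut bs bt nts ntb.
have eqit k : iter k (next t) b = iter k (next s) b /\
    next t (iter k (next t) b) = next s (iter k (next t) b).
  elim: k => [//|k [eqk eqn]]; rewrite !iterS -eqk eqn; split=> //.
  set a := iter k (next t) b in eqk eqn *.
  have at_ : a \in t by rewrite /a; elim: (k) => //= m; rewrite mem_next.
  have nta : next t a \in t by rewrite mem_next.
  rewrite -eqn; have [//|] := nts _ nta.
  rewrite {2}eqn prev_next // => e; have := iter_next_neq st ut at_.
  by rewrite e eqxx.
have fc c : fconnect (next t) b c = fconnect (next s) b c.
  apply/idP/idP => /iter_findex <-.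
    by rewrite (eqit _).1 fconnect_iter.
  by rewrite -(eqit _).1 fconnect_iter.
have : orbit (next t) b = orbit (next s) b.
  rewrite /orbit /order (eq_card fc); move: #|_| => m.
  apply: (@eq_from_nth _ b); rewrite !size_traject // => i im.
  by rewrite !nth_traject // (eqit _).1.
rewrite !(orbitE (cycle_next _)) // => /(congr1 (rotr (index b t))).
rewrite rotK => ->; rewrite /rotr rot_rot_add.
by eexists.
Qed.

End CycleSeq.

(** * Cycles closed by non-backtracking walks *)

Section NonBacktracking.
Variables (n : nat) (E : rel 'I_n).
Local Open Scope nat_scope.
Hypothesis noloop : irreflexive E.

Lemma nonbacktracking_catr (s1 s2 : seq 'I_n) :
  nonbacktracking (s1 ++ s2) -> nonbacktracking s2.
Proof.
elim: s1 => [//|x s1 IHs1] nb; apply: IHs1; move: nb => /=.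
by case: (s1 ++ s2) => [//|y [//|z s]] /andP[].
Qed.

Lemma is_walk_catr (s1 s2 : seq 'I_n) :
  s2 != [::] -> is_walk E (s1 ++ s2) -> is_walk E s2.
Proof.
case: s2 => // y s2 _; case: s1 => [//|x s1] /=.
by rewrite cat_path /= => /and3P[].
Qed.

Lemma scomp_eq (x y : 'I_n) :
  connect E x y -> connect E y x -> scomp E x = scomp E y.
Proof.
move=> xy yx; apply/setP => a; rewrite !inE.
have bi b c : (b == c) || (connect E c b && connect E b c) =
              (connect E c b && connect E b c).
  by case: eqP => [->|//]; rewrite connect0.
rewrite !bi; apply/andP/andP => -[h1 h2]; split.
- exact: connect_trans yx h1.
- exact: connect_trans h2 xy.
- exact: connect_trans xy h1.
- exact: connect_trans h2 yx.
Qed.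

(** The vertices of a directed cycle reach each other, so the cycle lies in one strong component. *)
Lemma cycle_is_ucycle (s : seq 'I_n) x : 2 < size s -> uniq s -> cycle E s ->
  x \in s -> is_ucycle E (scomp E x) s.
Proof.
move=> ss us cs xs; have co := connect_cycle cs.
have aC : all (mem (scomp E x)) s.
  by apply/allP => a as_; rewrite /= inE !co // orbT.
rewrite /is_ucycle ss us aC /=.
apply: (sub_in_cycle (P := mem (scomp E x)) _ aC cs) => a b aC' bC' Eab.
by rewrite /uadj /= aC' bC' Eab.
Qed.

(** Closing up after one step would need a loop, and after two steps a backtracking, so the piece
    closed at the first repetition has at least three vertices. *)
Lemma nb_walk_has_ucycle (s : seq 'I_n) :
  is_walk E s -> nonbacktracking s -> ~~ uniq s ->
  exists s1 y a z s2, [/\ s = s1 ++ [:: y, a & z] ++ y :: s2,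
    uniq (s1 ++ [:: y, a & z]) & is_ucycle E (scomp E y) [:: y, a & z]].
Proof.
move=> ws nbs /first_repetition[s1 [y [z [s2 [es us]]]]].
rewrite es in ws nbs; move/nonbacktracking_catr: nbs => nb.
move/is_walk_catr: ws => /(_ isT) w.
have uz : uniq (y :: z) by move: us; rewrite cat_uniq => /and3P[].
have cz : cycle E (y :: z).
  by move: w; rewrite /= -cat_rcons cat_path => /andP[].
case: z => [|a z] in es us uz cz nb w *.
  by move: w; rewrite /= noloop.
exists s1, y, a, z, s2; split => //; apply: cycle_is_ucycle; rewrite ?mem_head //.
by case: z nb {es us w cz uz} => //=; rewrite eqxx.
Qed.

Lemma nbstep_walk e es : E e.1 e.2 -> path (nbstep E) e es ->
  is_walk E [:: e.1, e.2 & map snd es] /\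
  nonbacktracking [:: e.1, e.2 & map snd es].
Proof.
elim: es e => [|f es IHes] e Ee /=; first by rewrite Ee.
case/andP=> /and3P[Ef /eqP fe fe1] pes.
have [/= /andP[_ wE] nb] := IHes f Ef pes.
by rewrite Ee -fe Ef fe1.
Qed.

Lemma nbstep_walk_arc e es s1 y a r : path (nbstep E) e es ->
  [:: e.1, e.2 & map snd es] = s1 ++ [:: y, a & r] -> (y, a) \in e :: es.
Proof.
elim: es e s1 => [|f es IHes] e [|b s1] /=.
- by move=> _ [<- <- _]; rewrite -surjective_pairing mem_head.
- by case: s1 => [|c [|d s1]] //= _ [].
- by move=> _ [<- <- _]; rewrite -surjective_pairing mem_head.
case/andP=> /and3P[Ef /eqP fe fe1] pes [_ eq_s].
by rewrite inE (IHes _ s1 pes) ?orbT // fe.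
Qed.

Lemma connect_nbstep_edge e f : E e.1 e.2 -> connect (nbstep E) e f -> E f.1 f.2.
Proof.
move=> Ee /connectP[p]; elim: p e Ee => [|g p IHp] e Ee /=; first by move=> _ ->.
by case/andP => /and3P[Eg _ _]; apply: IHp.
Qed.

Lemma connect_nbstep_vertex e f : E e.1 e.2 -> connect (nbstep E) e f ->
  connect E e.1 f.1.
Proof.
move=> Ee /connectP[p]; elim: p e Ee => [|g p IHp] e Ee /=.
  by move=> _ ->; rewrite connect0.
case/andP => /and3P[Eg /eqP ge _] pp lp.
by apply: connect_trans (IHp g Eg pp lp); rewrite ge connect1.
Qed.

(** The first step is explicit because [connect] is reflexive: the closed walk through [e] must have
    positive length. *)
Definition nbrecurrent (e : 'I_n * 'I_n) : Prop :=
  exists2 f, nbstep E e f & connect (nbstep E) f e.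

Lemma nbrecurrent_edge e : nbrecurrent e -> E e.1 e.2.
Proof. by case=> f /and3P[Ef _ _]; apply: connect_nbstep_edge. Qed.

Lemma nbrecurrent_trans e f : nbrecurrent e ->
  connect (nbstep E) e f -> connect (nbstep E) f e -> nbrecurrent f.
Proof.
move=> rec ef /connectP[[|g p] /=]; first by move=> _ <-.
case/andP=> fg pp lp; exists g => //; apply: connect_trans ef.
by apply/connectP; exists p.
Qed.

Lemma nbrecurrent_long e k : nbrecurrent e -> exists es,
  [/\ path (nbstep E) e es, k <= size es &
      all (fun f => connect (nbstep E) f e) es].
Proof.
case=> f ef /connectP[p pp lp].
elim: k => [|k [es [pes kes aes]]]; first by exists [::].
exists (f :: p ++ es); split.
- by rewrite /= ef cat_path pp /= -lp.
- by rewrite /= size_cat ltnS (leq_trans kes) // leq_addl.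
rewrite -cat_cons all_cat aes andbT; apply/allP => g gp.
case/splitPl: gp pp lp => p1 p2 <-; rewrite cat_path last_cat => /andP[_ pp2] lp.
by apply/connectP; exists p2.
Qed.

(* Follow the walk until its first repeated vertex: the loop closed there is a
   cycle, and it contains the starting vertex only if the walk closes up there. *)
Lemma nbrecurrent_ucycle e : nbrecurrent e -> exists g z,
  [/\ is_ucycle E (scomp E e.1) [:: g.1, g.2 & z],
      connect (nbstep E) e g, connect (nbstep E) g e &
      g = e \/ e.1 \notin [:: g.1, g.2 & z]].
Proof.
move=> rec; have Ee := nbrecurrent_edge rec.
(* With at least [n] arcs after [e] the walk visits at least [n + 2] vertices, so one of them is
   repeated. *)
have [es [pes les aes]] := nbrecurrent_long n rec.
have [ws nbs] := nbstep_walk Ee pes.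
have nu : ~~ uniq [:: e.1, e.2 & map snd es].
  apply/negP => /card_uniqP; rewrite /= size_map => h.
  have := max_card (mem [:: e.1, e.2 & map snd es]).
  by rewrite h card_ord ltnNge (leq_trans les).
have [s1 [y [a [z [s2 [es_ us uc]]]]]] := nb_walk_has_ucycle ws nbs nu.
have ya := nbstep_walk_arc pes es_.
have c1 : connect (nbstep E) e (y, a) by exact: path_connect pes _ ya.
have c2 : connect (nbstep E) (y, a) e.
  by move: ya; rewrite inE => /predU1P[->|/(allP aes)//]; rewrite connect0.
have Ey := connect_nbstep_edge Ee c1.
exists (y, a), z; split=> //.
  by rewrite (@scomp_eq e.1 y) //; [apply: (connect_nbstep_vertex Ee c1)
    | apply: (connect_nbstep_vertex Ey c2)].
case: s1 es_ us => [|b s1] /=.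
  by case=> <- <- _ _; left; rewrite -surjective_pairing.
by case=> <- _ /andP[]; rewrite mem_cat negb_or => /andP[_]; right.
Qed.

Lemma same_cycle_next (s t : seq 'I_n) x : uniq s ->
  same_cycle s t -> next t x = next s x \/ next t x = prev s x.
Proof.
move=> us [k [->|->]]; [left|right]; first by rewrite next_rot.
by rewrite next_rot ?rev_uniq // next_rev.
Qed.

Lemma same_cycle_mem (s t : seq 'I_n) : same_cycle s t -> s =i t.
Proof. by case=> k [->|->] x; rewrite mem_rot ?mem_rev. Qed.

(** The cycle found by [nbrecurrent_ucycle] is [z] up to rotation and reversal. It contains [e.1],
    hence it starts with [e] itself. *)
Lemma nbrecurrent_on_cycle e z : at_most_one_cycle E (scomp E e.1) ->
  is_ucycle E (scomp E e.1) z -> nbrecurrent e -> e.1 \in z ->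
  e.2 = next z e.1 \/ e.2 = prev z e.1.
Proof.
move=> amo uz rec ez.
have [g [q [uq _ _ hg]]] := nbrecurrent_ucycle rec.
have sc := amo _ _ uz uq.
case: hg => [ge|]; last by rewrite -(same_cycle_mem sc) ez.
have uz' : uniq z by case/and4P: uz.
have := same_cycle_next e.1 uz' sc.
by rewrite ge /= eqxx.
Qed.

(** Arcs that communicate with [e] and start on the cycle [z] run along [z], so the return from [g]
    to [e] stays on [z]. Then [f1] and [f2] both lead from [e.2] to a neighbour on [z] other than
    [e.1], and only one is left. *)
Lemma at_most_one_cycle_unbranched e f1 f2 :
  at_most_one_cycle E (scomp E e.1) ->
  nbstep E e f1 -> nbstep E e f2 ->
  connect (nbstep E) f1 e -> connect (nbstep E) f2 e -> f1 = f2.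
Proof.
move=> amo ef1 ef2 f1e f2e.
have rec : nbrecurrent e by exists f1.
have Ee := nbrecurrent_edge rec.
have [g [q [uz eg ge _]]] := nbrecurrent_ucycle rec.
set z := [:: g.1, g.2 & q] in uz.
have uz' : uniq z by case/and4P: uz.
have gz : g.1 \in z by rewrite mem_head.
have step h : connect (nbstep E) e h -> connect (nbstep E) h e -> h.1 \in z ->
    h.2 = next z h.1 \/ h.2 = prev z h.1.
  move=> eh he hz; have Eh := connect_nbstep_edge Ee eh.
  have sE : scomp E e.1 = scomp E h.1.
    by apply: scomp_eq; apply: connect_nbstep_vertex.
  apply: nbrecurrent_on_cycle => //; rewrite -?sE //.
  exact: nbrecurrent_trans rec eh he.
have step2 h : connect (nbstep E) e h -> connect (nbstep E) h e -> h.1 \in z ->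
    h.2 \in z.
  by move=> eh he hz; case: (step h eh he hz) => ->; rewrite ?mem_next ?mem_prev.
have reach h : connect (nbstep E) e h -> h.1 \in z -> connect (nbstep E) h e ->
    e.1 \in z.
  move=> eh hz /connectP[p]; elim: p h eh hz => [|h' p IHp] h eh hz /=.
    by move=> _ ->.
  case/andP=> hh' pp lp; apply: (IHp h') => //.
    exact: connect_trans eh (connect1 hh').
  have /and3P[_ /eqP -> _] := hh'; apply: step2 => //.
  by apply: connect_trans (connect1 hh') _; apply/connectP; exists p.
have ez : e.1 \in z := reach g eg gz ge.
have ve := step e (connect0 _ _) (connect0 _ _) ez.
have e2z := step2 e (connect0 _ _) (connect0 _ _) ez.
have /and3P[_ /eqP v1 w1] := ef1; have /and3P[_ /eqP v2 w2] := ef2.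
have := step f1 (connect1 ef1) f1e; rewrite v1 => /(_ e2z) s1.
have := step f2 (connect1 ef2) f2e; rewrite v2 => /(_ e2z) s2.
have ev : e.1 = next z e.2 \/ e.1 = prev z e.2.
  by case: ve => ->; [right; rewrite prev_next | left; rewrite next_prev].
rewrite [f1]surjective_pairing [f2]surjective_pairing v1 v2; congr pair.
by case: s1 s2 ev w1 w2 => -> [] -> [] -> //; rewrite eqxx.
Qed.

End NonBacktracking.

(** * Branching forced by two cycles *)

Section StronglyConnectedCycles.
Variable n : nat.
Local Open Scope nat_scope.
Implicit Types (F : rel 'I_n) (s t : seq 'I_n).

Definition undirected F : rel 'I_n := fun u v => F u v || F v u.

Definition remove_arc F (e : 'I_n * 'I_n) : rel 'I_n :=
  fun x y => F x y && ((x, y) != e).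

Definition arc_number F : nat := #|[pred e : 'I_n * 'I_n | F e.1 e.2]|.

Lemma undirected_sym F : symmetric (undirected F).
Proof. by move=> x y; rewrite /undirected orbC. Qed.

Lemma remove_arc_number F e : F e.1 e.2 ->
  arc_number (remove_arc F e) < arc_number F.
Proof.
move=> Fe; apply: proper_card; apply/fintype.properP; split.
  by apply/fintype.subsetP => f; rewrite !inE => /andP[].
by exists e; rewrite !inE // /remove_arc -surjective_pairing eqxx andbF.
Qed.

(** The path is rebuilt from its end: wherever it uses [(u, v)], its remainder already avoids that
    arc, and the assumption supplies another route from [u]. *)
Lemma connect_remove_arc F u v a b :
  (connect (remove_arc F (u, v)) v b -> connect (remove_arc F (u, v)) u b) ->
  connect F a b -> connect (remove_arc F (u, v)) a b.
Proof.
move=> uv /connectP[p]; elim: p a => [|c p IHp] a /=; first by move=> _ ->.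
case/andP=> Fac pp lp; have cb := IHp c pp lp.
have [[e1 e2]|ne] := eqVneq (a, c) (u, v); first by rewrite e1; apply: uv; move: cb; rewrite e2.
by apply: connect_trans (connect1 _) cb; rewrite /remove_arc Fac.
Qed.

Lemma connect_first_step F a b : connect F a b -> a != b ->
  exists2 c, F a c & connect F c b.
Proof.
case/connectP=> [[|c p]] /= pp lp; first by rewrite lp eqxx.
by move=> _; case/andP: pp => Fac pp; exists c => //; apply/connectP; exists p.
Qed.

Definition cycle_in F s := [&& 2 < size s, uniq s & cycle (undirected F) s].

(** The invariant of the arc deletions. The cycles are undirected, so one direction of each edge
    suffices, whereas the mutual reachability of their vertices is directed and may use other
    vertices. *)
Definition connected_cycles F s t := [/\ cycle_in F s, cycle_in F t &
  {in s ++ t &, forall a b, connect F a b}].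

Lemma cycle_in_remove F s u v : v \notin s -> cycle_in F s ->
  cycle_in (remove_arc F (u, v)) s.
Proof.
move=> vs /and3P[ss us cs]; rewrite /cycle_in ss us /=.
apply: (sub_in_cycle (P := mem s)) cs; last by apply/allP.
move=> a b /= as_ bs /orP h; apply/orP; rewrite /remove_arc !xpair_eqE.
have [va vb] : a != v /\ b != v by split; apply: contraNneq vs => <-.
by rewrite (negbTE va) (negbTE vb) !andbF !andbT.
Qed.

Lemma cycle_in_remove_rev F s u v : u != v -> F v u -> cycle_in F s ->
  cycle_in (remove_arc F (u, v)) s.
Proof.
move=> uv Fvu /and3P[ss us cs]; rewrite /cycle_in ss us /=.
have keep a b : F a b -> undirected (remove_arc F (u, v)) a b.
  move=> Fab; rewrite /undirected /remove_arc.
  have [[-> ->]|_] := eqVneq (a, b) (u, v); last by rewrite Fab.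
  by rewrite Fvu xpair_eqE eq_sym (negbTE uv) orbT.
by apply: sub_cycle cs => a b /orP[/keep //|/keep]; rewrite undirected_sym.
Qed.

Lemma cycle_in_neighbour F s u v : cycle_in F s -> v \in s ->
  exists2 x, x \in s & undirected F x v /\ x != u.
Proof.
case/and3P=> ss us cs vs.
have [e|] := eqVneq (prev s v) u; last first.
  by exists (prev s v); rewrite ?mem_prev // prev_cycle.
exists (next s v); rewrite ?mem_next // undirected_sym next_cycle // -e.
by split=> //; apply: next_neq_prev.
Qed.

(** A path through [(u, v)] that goes on must return to [u] at once, so only access to [v] is at
    stake. If [v] is on a cycle, it has a cycle neighbour [x] other than [u]; the edge between them
    can only point to [v], so [v] is still entered from [x]. The arc from [v] to [u] preserves the
    undirected edge. *)
Lemma remove_dead_end F s t u v : irreflexive F -> F u v ->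
  (forall w, F v w -> w = u) ->
  connected_cycles F s t -> connected_cycles (remove_arc F (u, v)) s t.
Proof.
move=> irrF Fuv dead [cs ct co].
have uv : u != v by apply: contraTneq Fuv => ->; rewrite irrF.
have co' a b : a \in s ++ t -> b \in s ++ t -> b != v ->
    connect (remove_arc F (u, v)) a b.
  move=> ast bst bv; apply: connect_remove_arc (co a b ast bst) => vb.
  have [|c /andP[/dead -> _] //] := connect_first_step vb.
  by rewrite eq_sym.
have [vst|vst] := boolP (v \in s ++ t); last first.
  have [vs vt] : v \notin s /\ v \notin t by apply/andP; rewrite -negb_or -mem_cat.
  split; [exact: cycle_in_remove|exact: cycle_in_remove|].
  by move=> a b ast bst; apply: co' => //; apply: contraNneq vst => <-.
have [x xst [xv xu]] : exists2 x, x \in s ++ t & undirected F x v /\ x != u.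
  move: vst; rewrite mem_cat => /orP[] h.
    have [x xs hx] := cycle_in_neighbour u cs h.
    by exists x; rewrite // mem_cat xs.
  have [x xs hx] := cycle_in_neighbour u ct h.
  by exists x; rewrite // mem_cat xs orbT.
have xNv : x != v.
  by apply: contraTneq xv => ->; rewrite /undirected irrF.
have Fxv : F x v.
  by case/orP: xv => // /dead e; rewrite e eqxx in xu.
have Fvu : F v u.
  have [|c Fvc _] := connect_first_step (co v x vst xst); first by rewrite eq_sym.
  by rewrite -(dead c).
split; [exact: cycle_in_remove_rev|exact: cycle_in_remove_rev|].
move=> a b ast bst; have [->|bv] := eqVneq b v; last exact: co'.
apply: connect_trans (co' a x ast xst xNv) (connect1 _).
by rewrite /remove_arc Fxv xpair_eqE (negbTE xu).
Qed.

Lemma remove_arc_sub F e : subrel (remove_arc F e) F.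
Proof. by move=> x y /andP[]. Qed.

Lemma connect_subrel (T : finType) (e e' : rel T) :
  subrel e e' -> subrel (connect e) (connect e').
Proof. by move=> ee'; apply: connect_sub => x y /ee' /connect1. Qed.

(** The vertex [v] is on neither cycle, and no path to a cycle vertex passes through it. *)
Lemma remove_astray F s t u v : F u v ->
  (forall b, b \in s ++ t -> ~~ connect F v b) ->
  connected_cycles F s t -> connected_cycles (remove_arc F (u, v)) s t.
Proof.
move=> Fuv stray [cs ct co].
have vst : v \notin s ++ t by apply/negP => /stray; rewrite connect0.
have [vs vt] : v \notin s /\ v \notin t by apply/andP; rewrite -negb_or -mem_cat.
split; [exact: cycle_in_remove|exact: cycle_in_remove|].
move=> a b ast bst; apply: connect_remove_arc (co a b ast bst).
by move/(connect_subrel (@remove_arc_sub F _)) => h; have := stray b bst; rewrite h.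
Qed.

End StronglyConnectedCycles.

(** Take a vertex of [P] with the fewest reachable vertices: whatever it reaches has the same
    reachable set, hence reaches it back. *)
Lemma sink_component (T : finType) (e : rel T) (P : pred T) x0 : P x0 ->
  (forall x y, P x -> e x y -> P y) ->
  exists2 x, P x & forall y, connect e x y -> connect e y x.
Proof.
move=> Px0 clP; case: (arg_minnP (fun x => #|connect e x|) Px0) => x Px xmin.
exists x => // y xy.
have Py : P y.
  case/connectP: xy => p; elim: p x Px {xmin} => [|z p IHp] x Px /=.
    by move=> _ ->.
  by case/andP=> exz; apply: IHp; apply: clP exz.
have yx : connect e y \subset connect e x.
  by apply/fintype.subsetP => z; rewrite !inE; apply: connect_trans.
have /eqP e_yx : #|connect e y| == #|connect e x|.
  by rewrite eqn_leq subset_leq_card //= xmin.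
by have := subset_cardP e_yx yx x; rewrite !inE connect0.
Qed.

(** * Terminal components of the arc graph without branching *)

Section UnbranchedSink.
Variables (n : nat) (F : rel 'I_n) (e0 : 'I_n * 'I_n).
Local Open Scope nat_scope.
Local Notation K := (connect (nbstep F) e0).
Hypothesis Fe0 : F e0.1 e0.2.
Hypothesis sinkK : forall f, K f -> connect (nbstep F) f e0.
Hypothesis extend : forall u v, F u v -> exists2 w, F v w & w != u.
Hypothesis unbranched : forall f f1 f2, K f -> nbstep F f f1 -> nbstep F f f2 -> f1 = f2.

(** On the component the default [f] is never taken, since [extend] provides a successor. *)
Let succ f := odflt f [pick g | nbstep F f g].

Local Lemma K_edge f : K f -> F f.1 f.2.
Proof. exact: connect_nbstep_edge. Qed.

Local Lemma succ_step f : K f -> nbstep F f (succ f).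
Proof.
move=> Kf; rewrite /succ; case: pickP => [//|no].
have [w Fw wu] := extend (K_edge Kf).
by have := no (f.2, w); rewrite /nbstep /= Fw eqxx wu.
Qed.

Local Lemma succ_K f : K f -> K (succ f).
Proof. by move=> Kf; apply: connect_trans Kf (connect1 (succ_step Kf)). Qed.

Local Lemma K_connect f g : K f -> K g -> connect (nbstep F) f g.
Proof. by move=> /sinkK fe; apply: connect_trans. Qed.

Local Lemma K_pred h : K h -> exists2 f, K f & nbstep F f h.
Proof.
move=> Kh; have /connectP[p] := K_connect (succ_K Kh) Kh.
case/lastP: p => [_ /= e|p g].
  by exists h => //; rewrite {2}e; apply: succ_step.
rewrite rcons_path last_rcons => /andP[pp lp] hg; rewrite -hg in lp.
exists (last (succ h) p) => //.
by apply: connect_trans (succ_K Kh) _; apply/connectP; exists p.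
Qed.

(** By [K_pred] the map [succ] sends the finite component onto itself, so it is injective there. *)
Local Lemma K_pred_inj f1 f2 g : K f1 -> K f2 ->
  nbstep F f1 g -> nbstep F f2 g -> f1 = f2.
Proof.
move=> K1 K2 s1 s2.
pose KS := [set f | K f].
suff inj : {in KS &, injective succ}.
  apply: inj; rewrite ?inE //.
  by rewrite (unbranched K1 (succ_step K1) s1) (unbranched K2 (succ_step K2) s2).
apply/imset_injP; rewrite eqn_leq leq_imset_card /= subset_leq_card //.
apply/fintype.subsetP => h; rewrite inE => Kh; have [f Kf fh] := K_pred Kh.
by apply/imsetP; exists f; rewrite ?inE // (unbranched Kf fh (succ_step Kf)).
Qed.

Definition sink_vertex v := [exists f, K f && (f.2 == v)].

(** Let [(u, v)] be an arc of the component. An arc out of [v] that does not return to [u] is the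
    unique successor [(v, w)]. *)
Lemma sink_vertex_out v : sink_vertex v -> exists u w,
  [/\ sink_vertex u, sink_vertex w, K (u, v), K (v, w) &
      w != u /\ forall x, F v x -> x = u \/ x = w].
Proof.
case/existsP=> -[u v'] /andP[Kf /= /eqP e]; rewrite {v'}e in Kf.
have sf := succ_step Kf; have Ks := succ_K Kf.
move: sf Ks; case: (succ _) => v' w /and3P[/= Fvw /eqP e uw]; rewrite {v'}e in Fvw *.
move=> Ks; exists u, w; split=> //; last 1 first.
- split=> // x Fvx; have [->|xu] := eqVneq x u; [by left|right].
  suff [] : (v, x) = (v, w) by [].
  by apply: unbranched Kf _ _; rewrite /nbstep /= ?Fvx ?Fvw eqxx.
- have [g Kg /and3P[_ /= /eqP e _]] := K_pred Kf.
  by apply/existsP; exists g; rewrite Kg -e eqxx.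
- by apply/existsP; exists (v, w); rewrite Ks eqxx.
Qed.

Lemma sink_vertex_closed v x : sink_vertex v -> F v x -> sink_vertex x.
Proof.
by move=> /sink_vertex_out[u [w [su sw _ _ [_ h]]]] /h[] ->.
Qed.

Lemma sink_vertex_connect v x : sink_vertex v -> connect F v x -> sink_vertex x.
Proof.
move=> sv /connectP[p]; elim: p v sv => [|y p IHp] v sv /=; first by move=> _ ->.
by case/andP=> Fvy; apply: IHp; apply: sink_vertex_closed Fvy.
Qed.

(** Incoming arcs add no neighbour. For an arc from [x] to [v], either [(v, x)] is an arc of the
    component and [sink_vertex_out] applies, or [(x, v)] is one; in that case, unless [x] is [w], it
    precedes [(v, w)] and so equals [(u, v)]. *)
Lemma sink_vertex_degree2 v : sink_vertex v -> exists u w,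
  forall x, sink_vertex x -> undirected F v x -> x = u \/ x = w.
Proof.
move=> /sink_vertex_out[u [w [su sw Ku Kw [wu h]]]]; exists u, w => x sx.
case/orP=> [/h //|Fxv].
have [y [z [_ _ Ky Kz [_ hx]]]] := sink_vertex_out sx.
have [vy|vz] := hx v Fxv.
  by apply: h; rewrite vy; have := K_edge Ky.
have [->|xw] := eqVneq x w; [by right|left].
rewrite -vz in Kz.
suff [] : (x, v) = (u, v) by [].
apply: (@K_pred_inj _ _ (v, w)) => //; rewrite /nbstep /= (K_edge Kw) eqxx /=.
  by rewrite eq_sym.
exact: wu.
Qed.

Variables s t : seq 'I_n.
Hypothesis connected : connected_cycles F s t.
Hypothesis reach : exists2 b, b \in s ++ t & connect F e0.2 b.

Local Lemma st_sink a : a \in s ++ t -> sink_vertex a.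
Proof.
move=> ast; have [b bst e0b] := reach; have [_ _ co] := connected.
apply: sink_vertex_connect (co b a bst ast); apply: sink_vertex_connect e0b.
by apply/existsP; exists e0; rewrite connect0 eqxx.
Qed.

Local Lemma cycle_neighbours q a x : cycle_in F q -> {subset q <= s ++ t} ->
  a \in q -> sink_vertex x -> undirected F a x -> x = next q a \/ x = prev q a.
Proof.
case/and3P=> sq uq cq qst aq sx ax.
have [u [w h]] := sink_vertex_degree2 (st_sink (qst a aq)).
have := h x sx ax.
have := h (next q a) (st_sink (qst _ _)) (next_cycle cq aq).
rewrite mem_next => /(_ aq).
have := h (prev q a) (st_sink (qst _ _)).
rewrite mem_prev undirected_sym => /(_ aq (prev_cycle cq aq)).
have := next_neq_prev sq uq aq.
by case: eqP => // ne _ [] p_ [] n_ [] ->; rewrite -?p_ -?n_; auto; case: ne; rewrite p_ n_.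
Qed.

(** All vertices of [s] and [t] are sink vertices, so their only sink neighbours are their two
    neighbours on the cycle. Directed paths from [s] therefore stay on [s], whence [t] lies in [s]
    and moves along its edges, in the direction of [s] or of [rev s]. *)
Lemma unbranched_sink_same_cycle : same_cycle s t.
Proof.
have [cs ct co] := connected.
have ss : {subset s <= s ++ t} by move=> a; rewrite mem_cat => ->.
have st : {subset t <= s ++ t} by move=> a; rewrite mem_cat orbC => ->.
have /and3P[sz_s us cys] := cs; have /and3P[sz_t ut cyt] := ct.
have [a as_] : exists a, a \in s by case: (s) sz_s => // a q; exists a; rewrite mem_head.
have [b bt] : exists b, b \in t by case: (t) sz_t => // b q; exists b; rewrite mem_head.
have ts : {subset t <= s}.
  move=> {bt}b bt; have /connectP[p] := co a b (ss _ as_) (st _ bt).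
  elim: p a as_ => [|c p IHp] a as_ /=; first by move=> _ ->.
  case/andP=> Fac; apply: IHp.
  have Uac : undirected F a c by rewrite /undirected Fac.
  have sc : sink_vertex c by apply: sink_vertex_closed (st_sink (ss _ as_)) Fac.
  by have [->|->] := cycle_neighbours cs ss as_ sc Uac; rewrite ?mem_next ?mem_prev.
have nt c : c \in t -> next t c = next s c \/ next t c = prev s c.
  move=> ct_; apply: cycle_neighbours (ts _ ct_) _ _ => //.
    by apply: st_sink; apply: st; rewrite mem_next.
  exact: next_cycle.
have [ntb|ntb] := nt b bt.
  have [k ->] := rot_eq_of_next sz_t us ut (ts _ bt) bt nt ntb.
  by exists k; left.
have [k ->] : exists k, t = rot k (rev s).
  apply: (@rot_eq_of_next _ _ _ b) => //; rewrite ?rev_uniq ?mem_rev ?next_rev ?ts //.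
  by move=> c /nt; rewrite next_rev // prev_rev // => -[]; auto.
by exists k; right.
Qed.

End UnbranchedSink.

(** * Deleting arcs until two cycles force a branching *)

Section Branching.
Variable n : nat.
Local Open Scope nat_scope.
Implicit Types (E F : rel 'I_n) (s t : seq 'I_n).

Definition nbbranching F : Prop := exists e f1 f2,
  [/\ nbstep F e f1, nbstep F e f2, f1 != f2,
      connect (nbstep F) f1 e & connect (nbstep F) f2 e].

Lemma nbstep_sub F F' : subrel F' F -> subrel (nbstep F') (nbstep F).
Proof. by move=> sub e f /and3P[/sub Ff ? ?]; apply/and3P. Qed.

Lemma nbrecurrent_sub F F' e : subrel F' F -> nbrecurrent F' e -> nbrecurrent F e.
Proof.
move=> sub [f ef fe]; exists f; first exact: nbstep_sub ef.
exact: connect_subrel (nbstep_sub sub) _ _ fe.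
Qed.

Lemma nbbranching_sub F F' : subrel F' F -> nbbranching F' -> nbbranching F.
Proof.
move=> sub [e [f1 [f2 [ef1 ef2 ne c1 c2]]]]; exists e, f1, f2.
have cs := connect_subrel (nbstep_sub sub).
by split=> //; [apply: nbstep_sub ef1|apply: nbstep_sub ef2|apply: cs|apply: cs].
Qed.

(* After deleting useless arcs, every arc extends without backtracking, so the
   arc graph has a terminal strong component; if that component is a mere
   circuit it visits all of s and t, which then have no room to differ. *)
Lemma connected_cycles_branching F s t : irreflexive F -> connected_cycles F s t ->
  (exists e, nbrecurrent F e) /\ (nbbranching F \/ same_cycle s t).
Proof.
move: {2}(arc_number F) (leqnn (arc_number F)) => m.
elim: m F => [|m IHm] F Fm irrF con.
  have [/and3P[ss us cs] _ _] := con.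
  case: s ss us cs {con} => // a s _ _ cs.
  have /orP := next_cycle cs (mem_head a s).
  have F0 e : F e.1 e.2 = false.
    by move: Fm; rewrite leqn0 => /eqP/card0_eq/(_ e).
  by case=> h; [have := F0 (a, next (a :: s) a)|have := F0 (next (a :: s) a, a)];
    rewrite /= h.
have lift e : F e.1 e.2 -> connected_cycles (remove_arc F e) s t ->
    (exists e, nbrecurrent F e) /\ (nbbranching F \/ same_cycle s t).
  move=> Fe con'.
  have sub : subrel (remove_arc F e) F by exact: remove_arc_sub.
  have [||//|[f rec] br] := IHm (remove_arc F e).
  - by rewrite -ltnS (leq_trans (remove_arc_number Fe)).
  - by move=> x; rewrite /remove_arc irrF.
  split; first by exists f; apply: nbrecurrent_sub rec.
  by case: br => [/(nbbranching_sub sub)|]; auto.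
have [/existsP[[u v] /andP[/= Fuv /forallP dead]]|noDead] :=
    boolP [exists e : 'I_n * 'I_n, F e.1 e.2 && [forall w, F e.2 w ==> (w == e.1)]].
  apply: (lift (u, v)) => //; apply: remove_dead_end => // w Fvw.
  by apply/eqP; apply: implyP (dead w) Fvw.
have [/existsP[[u v] /andP[/= Fuv /forallP astray]]|noAstray] :=
    boolP [exists e : 'I_n * 'I_n, F e.1 e.2 &&
             [forall b, (b \in s ++ t) ==> ~~ connect F e.2 b]].
  apply: (lift (u, v)) => //; apply: remove_astray => // b bst.
  exact: implyP (astray b) bst.
have extend u v : F u v -> exists2 w, F v w & w != u.
  move=> Fuv; move: noDead; rewrite negb_exists => /forallP/(_ (u, v)).
  by rewrite /= Fuv /= negb_forall => /existsP[w]; rewrite negb_imply => /andP[]; exists w.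
have reach u v : F u v -> exists2 b, b \in s ++ t & connect F v b.
  move=> Fuv; move: noAstray; rewrite negb_exists => /forallP/(_ (u, v)).
  rewrite /= Fuv /= negb_forall => /existsP[b]; rewrite negb_imply negbK => /andP[].
  by exists b.
have [e0 Fe0] : exists e : 'I_n * 'I_n, F e.1 e.2.
  have [/and3P[ss us cs] _ _] := con.
  case: (s) ss us cs => // a q _ _ cs.
  by have /orP[h|h] := next_cycle cs (mem_head a q); eexists (_, _); exact: h.
have [|e Fe sinkK] := sink_component (e := nbstep F) (P := fun e => F e.1 e.2) Fe0.
  by move=> x y _ /and3P[].
have [w Fw we] := extend _ _ Fe.
have ef : nbstep F e (e.2, w) by rewrite /nbstep /= Fw eqxx we.
split; first by exists e, (e.2, w) => //; apply/sinkK/connect1.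
have [br|nobr] := pselect (nbbranching F); [by left|right].
apply: (@unbranched_sink_same_cycle _ F e) => //; last exact: reach Fe.
(* Every continuation inside a terminal component returns, so two distinct successors would form a
   branching. *)
move=> f f1 f2 Kf s1 s2; apply/eqP/negPn/negP => ne; apply: nobr.
have ret g : nbstep F f g -> connect (nbstep F) g f.
  move=> fg; apply: connect_trans (Kf); apply: sinkK.
  exact: connect_trans Kf (connect1 fg).
by exists f, f1, f2; split=> //; apply: ret.
Qed.

(** With [t] equal to [s] this still yields a recurrent arc from a single cycle. *)
Lemma ucycles_branching E x s t : irreflexive E ->
  is_ucycle E (scomp E x) s -> is_ucycle E (scomp E x) t ->
  (exists e, nbrecurrent E e) /\ (nbbranching E \/ same_cycle s t).
Proof.
move=> irrE /and4P[ss us as_ cs] /and4P[st ut at_ ct].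
have sub : subrel (uadj E (scomp E x)) (undirected E) by move=> a b /and3P[].
apply: connected_cycles_branching => //; split.
- by rewrite /cycle_in ss us (sub_cycle sub).
- by rewrite /cycle_in st ut (sub_cycle sub).
have inC a : a \in s ++ t -> connect E x a && connect E a x.
  rewrite mem_cat => /orP[/(allP as_)|/(allP at_)]; rewrite /= inE => /predU1P[->|//];
    by rewrite connect0.
by move=> a b /inC/andP[_ ax] /inC/andP[xb _]; apply: connect_trans xb.
Qed.

End Branching.

(** * Growth of the number of walks *)

Section Growth.
Variables (n : nat) (E : rel 'I_n).
Local Open Scope nat_scope.

(** Unlike [nbext], this fixes the last arc, so that closed walks can be concatenated. *)
Fixpoint nbarc_walks (k : nat) (e f : 'I_n * 'I_n) : nat :=
  if k is k'.+1 then \sum_(g | nbstep E e g) nbarc_walks k' g f else (e == f : nat).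

Lemma nbarc_walks_add k l e g f :
  nbarc_walks k e g * nbarc_walks l g f <= nbarc_walks (k + l) e f.
Proof.
elim: k e => [|k IHk] e /=.
  by case: eqP => [->|]; rewrite ?mul1n ?mul0n.
by rewrite big_distrl /=; apply: leq_sum => h _; apply: IHk.
Qed.

Lemma nbarc_walks_step k e g f : nbstep E e g ->
  nbarc_walks k g f <= nbarc_walks k.+1 e f.
Proof. by move=> eg; rewrite /= (bigD1 g) //= leq_addr. Qed.

Lemma nbarc_walks_connect e f : connect (nbstep E) e f ->
  exists k, 0 < nbarc_walks k e f.
Proof.
case/connectP=> p; elim: p e => [|g p IHp] e /=.
  by move=> _ ->; exists 0; rewrite /= eqxx.
case/andP=> eg pp lp; have [k hk] := IHp g pp lp; exists k.+1.
exact: leq_trans hk (nbarc_walks_step _ _ eg).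
Qed.

Lemma nbarc_walks_pow c L e m : c <= nbarc_walks L e e ->
  c ^ m <= nbarc_walks (m * L) e e.
Proof.
move=> cL; elim: m => [|m IHm]; first by rewrite /= eqxx.
rewrite expnS mulSn (leq_trans _ (nbarc_walks_add _ _ _ e _)) //.
exact: leq_mul.
Qed.

Lemma nbarc_walks_le_ext k e f : nbarc_walks k e f <= nbext E k e f.2.
Proof.
elim: k e => [|k IHk] e /=; last exact: leq_sum.
by case: eqP => [->|]; rewrite ?eqxx.
Qed.

Lemma nbarc_walks_le_count k e f : E e.1 e.2 ->
  nbarc_walks k e f <= nbtw_count E k.+1 e.1 f.2.
Proof.
move=> Ee; rewrite nbtw_countS (leq_trans (nbarc_walks_le_ext _ _ _)) //.
by rewrite (bigD1 e.2) //= -surjective_pairing leq_addr.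
Qed.

Lemma nbrecurrent_count e : nbrecurrent E e -> exists L i j,
  0 < L /\ forall m, 0 < nbtw_count E (m * L).+1 i j.
Proof.
move=> rec; have Ee := nbrecurrent_edge rec; case: rec => f ef /nbarc_walks_connect[k hk].
exists k.+1, e.1, e.2; split=> // m.
apply: leq_trans (nbarc_walks_le_count _ _ Ee); rewrite -(exp1n m).
by apply: nbarc_walks_pow; apply: leq_trans hk (nbarc_walks_step _ _ ef).
Qed.

(* Going round the two loops in either order gives two closed walks of equal length. *)
Lemma nbbranching_count : nbbranching E -> exists L i j,
  0 < L /\ forall m, 2 ^ m <= nbtw_count E (m * L).+1 i j.
Proof.
case=> e [f1 [f2 [ef1 ef2 ne c1 c2]]].
have Ee : E e.1 e.2 by apply: nbrecurrent_edge; exists f1.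
have [k1 h1] := nbarc_walks_connect c1; have [k2 h2] := nbarc_walks_connect c2.
exists (k1.+1 + k2.+1), e.1, e.2; split=> // m.
apply: leq_trans (nbarc_walks_le_count _ _ Ee); apply: nbarc_walks_pow.
(* Closed walks beginning with [f1] and with [f2] belong to different summands; each summand is at
   least one. *)
rewrite addSn /= (bigD1 f1) //= (bigD1 f2) /=; last by rewrite ef2 eq_sym.
rewrite addnA (leq_trans _ (leq_addr _ _)) // (@leq_add 1 1) //.
  apply: leq_trans (nbarc_walks_add k1 k2.+1 f1 e e); rewrite muln_gt0 h1 /=.
  exact: leq_trans h2 (nbarc_walks_step _ _ ef2).
rewrite addnC addSnnS; apply: leq_trans (nbarc_walks_add k2 k1.+1 f2 e e).
rewrite muln_gt0 h2; exact: leq_trans h1 (nbarc_walks_step _ _ ef1).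
Qed.

(** This bounds the growth rate by [1 + n * n / A], with [A] free. The exponent counts the arcs
    reachable from [e]. At most one successor can return to [e]; the others, at most [n * n], no
    longer reach [e] and so save a factor [A]. *)
Lemma unbranched_nbext_le A k e j : 0 < A -> ~ nbbranching E ->
  nbext E k e j * A ^ k <= A ^ #|connect (nbstep E) e| * (A + n * n) ^ k.
Proof.
move=> A0 nobr; elim: k e => [|k IHk] e.
  by rewrite !expn0 !muln1 (leq_trans (leq_b1 _)) // expn_gt0 A0.
pose h f := #|connect (nbstep E) f|; rewrite -/(h e).
pose B := A ^ h e * (A + n * n) ^ k.
have sub f : nbstep E e f -> connect (nbstep E) f \subset connect (nbstep E) e.
  move=> ef; apply/fintype.subsetP => g; rewrite !inE.
  exact: connect_trans (connect1 ef).
have ret f : nbstep E e f -> A * (nbext E k f j * A ^ k) <= A * B.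
  move=> ef; rewrite leq_mul2l (leq_trans (IHk f)) ?orbT // leq_mul2r.
  by rewrite leq_pexp2l ?orbT // subset_leq_card // sub.
have noret f : nbstep E e f -> ~~ connect (nbstep E) f e ->
    A * (nbext E k f j * A ^ k) <= B.
  move=> ef nfe; apply: leq_trans (leq_mul (leqnn A) (IHk f)) _.
  rewrite mulnA leq_mul2r -expnS leq_pexp2l ?orbT // proper_card //.
  by apply/fintype.properP; split; [exact: sub | exists e; rewrite !inE ?connect0].
have small (P : pred ('I_n * 'I_n)) : (forall f, P f -> A * (nbext E k f j * A ^ k) <= B) ->
    \sum_(f | P f) A * (nbext E k f j * A ^ k) <= n * n * B.
  move=> hP; apply: (@leq_trans (\sum_(f | P f) B)); first exact: leq_sum.
  rewrite sum_nat_const leq_mul2r; apply/orP; right.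
  by rewrite (leq_trans (max_card _)) // card_prod !card_ord.
have -> : A ^ h e * (A + n * n) ^ k.+1 = A * B + n * n * B.
  by rewrite /B expnS; ring.
have -> : nbext E k.+1 e j * A ^ k.+1 =
    \sum_(f | nbstep E e f) A * (nbext E k f j * A ^ k).
  by rewrite /= big_distrl /=; apply: eq_bigr => f _; rewrite expnS mulnCA.
have [/existsP[f0 /andP[ef0 f0e]]|none] :=
    boolP [exists f, nbstep E e f && connect (nbstep E) f e]; last first.
  apply: leq_trans (small _ _) (leq_addl _ _) => f ef; apply: noret => //.
  by move: none; rewrite negb_exists => /forallP/(_ f); rewrite ef.
rewrite (bigD1 f0) //= leq_add ?ret //; apply: small => f /andP[ef ff0].
by apply: noret => //; apply/negP => fe; apply: nobr; exists e, f, f0.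
Qed.

Lemma unbranched_count_le A k i j : 0 < A -> ~ nbbranching E ->
  nbtw_count E k.+1 i j * A ^ k <= n * A ^ (n * n) * (A + n * n) ^ k.
Proof.
move=> A0 nobr; rewrite nbtw_countS big_distrl /= -mulnA.
have le y : E i y -> nbext E k (i, y) j * A ^ k <= A ^ (n * n) * (A + n * n) ^ k.
  move=> _; apply: leq_trans (unbranched_nbext_le _ _ _ A0 nobr) _.
  rewrite leq_mul2r leq_pexp2l ?orbT // (leq_trans (max_card _)) //.
  by rewrite card_prod !card_ord.
apply: (@leq_trans (\sum_(y | E i y) A ^ (n * n) * (A + n * n) ^ k)).
  exact: leq_sum.
rewrite sum_nat_const leq_mul2r.
by apply/orP; right; rewrite (leq_trans (max_card _)) // card_ord.
Qed.

Hypothesis noloop : irreflexive E.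

Lemma at_most_one_cycle_nobranching :
  (forall x, at_most_one_cycle E (scomp E x)) -> ~ nbbranching E.
Proof.
move=> amo [e [f1 [f2 [ef1 ef2 /eqP ne c1 c2]]]]; apply: ne.
exact: at_most_one_cycle_unbranched (amo e.1) ef1 ef2 c1 c2.
Qed.

Lemma acyclic_count_eq0 k i j : (forall x, acyclic_on E (scomp E x)) ->
  n <= k -> nbtw_count E k i j = 0.
Proof.
move=> acy nk; rewrite nbtw_countE eq_card0 // => w; rewrite !inE.
apply/negP => /and3P[wE nb _].
have nu : ~~ uniq (i :: w).
  apply/negP => /card_uniqP h; have := max_card (mem (i :: w)).
  by rewrite h card_ord /= size_tuple ltnNge nk.
have [_ [y [a [z [_ [_ _ uc]]]]]] := nb_walk_has_ucycle noloop (wE : is_walk E (i :: w)) nb nu.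
by have := acy y [:: y, a & z]; rewrite uc.
Qed.

Lemma tree_or_isolated_acyclic x :
  is_tree_on E (scomp E x) \/ isolated_node_on (scomp E x) ->
  acyclic_on E (scomp E x).
Proof.
case=> [[] //|c1] s; apply/negP => /and4P[ss us as_ _].
have : size s <= #|scomp E x|.
  rewrite -(card_uniqP us); apply: subset_leq_card; apply/fintype.subsetP.
  by move=> a /(allP as_).
by rewrite c1 leqNgt (ltn_trans _ ss).
Qed.

End Growth.

(** * The generating function *)

Section Recurrence.
Variables (R : realType) (n : nat) (E : rel 'I_n).
Local Notation A := (adj R E).
Local Notation S := (symp R E).
Local Notation D := (degD R E).
Local Notation p := (pk R E).

Let q (k : nat) (x y j : 'I_n) : R := (nbext E k (x, y) j)%:R.

Local Lemma pk0E i j : p 0 i j = (i == j)%:R.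
Proof. by rewrite !mxE nbtw_count0. Qed.

Local Lemma pkSE k i j : p k.+1 i j = \sum_x A i x * q k i x j.
Proof.
rewrite mxE nbtw_countS natr_sum big_mkcond /=; apply: eq_bigr => x _.
by rewrite mxE; case: (E i x); rewrite ?mul1r ?mul0r.
Qed.

Local Lemma qSE k u v j : q k.+1 u v j = p k.+1 v j - A v u * q k v u j.
Proof.
by rewrite mxE (nbtw_count_split E k u) natrD natrM mxE addrK.
Qed.

Local Lemma q0E u v j : q 0 u v j = (v == j)%:R. Proof. by []. Qed.

Local Lemma symp_sum i : \sum_x S i x = D i i.
Proof. by rewrite !mxE eqxx mul1r; apply: eq_bigr => x _; rewrite !mxE. Qed.

Local Lemma symp_adj i x : S i x * A i x = S i x.
Proof.
by rewrite !mxE; case: (E i x); rewrite ?mulr0 ?mul0r ?mul1r ?mulr1.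
Qed.

Local Lemma symp_adjT i x : S i x * A x i = S i x.
Proof.
by rewrite !mxE; case: (E x i); rewrite ?mulr0 ?mul0r ?mul1r ?mulr1.
Qed.

Local Lemma pk1E i j : p 1 i j = A i j.
Proof.
rewrite pkSE (bigD1 j) //= q0E eqxx mulr1 big1 ?addr0 // => x /negbTE xj.
by rewrite q0E xj mulr0.
Qed.

Local Lemma pkSSE k i j :
  p k.+2 i j = \sum_x A i x * p k.+1 x j - \sum_x S i x * q k x i j.
Proof.
rewrite pkSE -sumrB; apply: eq_bigr => x _; rewrite qSE mulrBr mulrA.
by rewrite [S i x]mxE.
Qed.

(** Expanding [q] once and comparing with [pkSSE] leaves only the counts [p]; this closes the
    recurrence. *)
Local Lemma symp_q k i j : \sum_x S i x * q k i x j =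
  \sum_x S i x * p k x j - \sum_x A i x * p k x j + p k.+1 i j.
Proof.
case: k => [|k].
  rewrite pk1E (bigD1 j) //= q0E eqxx mulr1 big1 ?addr0; last first.
    by move=> x /negbTE xj; rewrite q0E xj mulr0.
  have sum0 (B : 'M[R]_n) : \sum_x B i x * p 0 x j = B i j.
    rewrite (bigD1 j) //= pk0E eqxx mulr1 big1 ?addr0 // => x /negbTE xj.
    by rewrite pk0E xj mulr0.
  by rewrite !sum0 subrK.
rewrite pkSSE addrA subrK -sumrB; apply: eq_bigr => x _.
by rewrite qSE mulrBr mulrA symp_adjT.
Qed.

(** The coefficient here is [D], against [D - 1] in [pk_rec3]: this defect is the source of
    [- t ^+ 2] on the right of the generating identity. *)
Lemma pk_rec2 i j : p 2 i j = \sum_x A i x * p 1 x j - D i i * (i == j)%:R.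
Proof.
rewrite pkSSE; congr (_ - _); rewrite -symp_sum big_distrl /=.
by apply: eq_bigr => x _; rewrite q0E.
Qed.

Lemma pk_rec3 k i j : p k.+3 i j = \sum_x A i x * p k.+2 x j
  - (D i i - 1) * p k.+1 i j - \sum_x (A i x - S i x) * p k x j.
Proof.
rewrite pkSSE.
have -> : \sum_x S i x * q k.+1 x i j =
    D i i * p k.+1 i j - \sum_x S i x * q k i x j.
  rewrite -symp_sum big_distrl /= -sumrB; apply: eq_bigr => x _.
  by rewrite qSE mulrBr mulrA symp_adj.
rewrite symp_q.
have -> : \sum_x (A i x - S i x) * p k x j =
    \sum_x A i x * p k x j - \sum_x S i x * p k x j.
  by rewrite -sumrB; apply: eq_bigr => x _; rewrite mulrBl.
ring.
Qed.

Definition pterm (t : R) i j : nat -> R := fun k => p k i j * t ^+ k.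

(** The truncations are staggered so that every term stops at degree [N + 2]; the identity is then
    exact for each [N], without a remainder. *)
Lemma partial_sum_identity (t : R) i j N :
  series (pterm t i j) N.+3 - \sum_x A i x * t * series (pterm t x j) N.+2
  + (D i i - 1) * t ^+ 2 * series (pterm t i j) N.+1
  + \sum_x (A i x - S i x) * t ^+ 3 * series (pterm t x j) N
  = (1 - t ^+ 2) * (i == j)%:R.
Proof.
have serS u M : series (u : R^nat) M.+1 = series u M + u M.
  by rewrite !seriesEnat /= big_nat_recr.
have ptE k : pterm t i j k = p k i j * t ^+ k by [].
elim: N => [|N IHN].
  have s0 u : series (u : R^nat) 0 = 0 by rewrite seriesEnat /= big_geq.
  rewrite [X in _ + X]big1 => [|x _]; last by rewrite s0 mulr0.
  rewrite !serS s0 !add0r addr0 !ptE pk_rec2.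
  have -> : \sum_x A i x * t * series (pterm t x j) 2 =
     t * p 1 i j + t ^+ 2 * \sum_x A i x * p 1 x j.
    rewrite pk1E.
    have -> : A i j = \sum_x A i x * p 0 x j.
      rewrite (bigD1 j) //= pk0E eqxx mulr1 big1 ?addr0 // => x /negbTE xj.
      by rewrite pk0E xj mulr0.
    rewrite !mulr_sumr -big_split /=; apply: eq_bigr => x _.
    by rewrite !serS s0 /pterm expr0 expr1; ring.
  rewrite !pk0E expr0 expr1; ring.
rewrite -{}IHN [in LHS]serS [series (pterm t i j) N.+2]serS.
have -> : \sum_x A i x * t * series (pterm t x j) N.+3 =
  \sum_x A i x * t * series (pterm t x j) N.+2
  + t ^+ N.+3 * \sum_x A i x * p N.+2 x j.
  rewrite mulr_sumr -big_split /=; apply: eq_bigr => x _.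
  by rewrite serS /pterm !exprS; ring.
have -> : \sum_x (A i x - S i x) * t ^+ 3 * series (pterm t x j) N.+1 =
  \sum_x (A i x - S i x) * t ^+ 3 * series (pterm t x j) N
  + t ^+ N.+3 * \sum_x (A i x - S i x) * p N x j.
  rewrite mulr_sumr -big_split /=; apply: eq_bigr => x _.
  by rewrite serS /pterm !exprS; ring.
rewrite !ptE pk_rec3 !exprS; ring.
Qed.

End Recurrence.

(** * Passing to the limit in the recurrence *)

Section GeneratingFunction.
Local Open Scope classical_set_scope.
Local Open Scope ring_scope.
Variables (R : realType) (n : nat) (E : rel 'I_n).
Local Notation A := (adj R E).
Local Notation S := (symp R E).
Local Notation D := (degD R E).
Local Notation p := (pk R E).
Local Notation M := (deformed_laplacian R E).

Definition nbconv (t : R) : Prop := forall i j, cvgn (series (pterm E t i j)).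

Definition nbgen (t : R) : 'M[R]_n := \matrix_(i, j) limn (series (pterm E t i j)).

Lemma deformed_laplacian_horner t i j : (M i j).[t] =
  (i == j)%:R - A i j * t + (D i j - (i == j)%:R) * t ^+ 2
  + (A i j - S i j) * t ^+ 3.
Proof. by rewrite [M i j]mxE !hornerE. Qed.

Lemma deformed_laplacian_nbgen t : nbconv t ->
  map_mx (horner_eval t) M *m nbgen t = (1 - t ^+ 2)%:M.
Proof.
move=> ct; apply/matrixP => i j.
pose P x := series (pterm E t x j); pose L x := limn (P x).
have cP x m : (fun N => P x (N + m)%N) @ \oo --> L x.
  by rewrite (cvg_shiftn m (P x)); exact: ct.
rewrite mxE [RHS]mxE; transitivity (L i - \sum_x A i x * t * L x
    + (D i i - 1) * t ^+ 2 * L i + \sum_x (A i x - S i x) * t ^+ 3 * L x).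
  have Di x : x != i -> D i x = 0 by move=> xi; rewrite mxE eq_sym (negbTE xi) mul0r.
  rewrite (bigD1 i) //= [\sum_x A i x * t * L x](bigD1 i) //=.
  rewrite [\sum_x (A i x - S i x) * t ^+ 3 * L x](bigD1 i) //=.
  have -> : \sum_(x | x != i) map_mx (horner_eval t) M i x * nbgen t x j =
     - (\sum_(x | x != i) A i x * t * L x)
     + \sum_(x | x != i) (A i x - S i x) * t ^+ 3 * L x.
    rewrite -sumrN -big_split /=; apply: eq_bigr => x xi.
    rewrite [map_mx _ _ _ _]mxE [nbgen _ _ _]mxE /horner_eval.
    rewrite deformed_laplacian_horner Di // eq_sym (negbTE xi) -/(P x) -/(L x).
    by rewrite /=; ring.
  rewrite [map_mx _ _ _ _]mxE [nbgen _ _ _]mxE /horner_eval.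
  rewrite deformed_laplacian_horner eqxx -/(P i) -/(L i) /=.
  by ring.
suff lim : (fun N : nat => P i (N + 3)%N - \sum_x A i x * t * P x (N + 2)%N
    + (D i i - 1) * t ^+ 2 * P i (N + 1)%N
    + \sum_x (A i x - S i x) * t ^+ 3 * P x (N + 0)%N) @ \oo -->
  (L i - \sum_x A i x * t * L x
    + (D i i - 1) * t ^+ 2 * L i + \sum_x (A i x - S i x) * t ^+ 3 * L x).
  move: lim; rewrite (_ : (fun N : nat => _) = cst ((1 - t ^+ 2) * (i == j)%:R)).
    move=> lim; rewrite -mulr_natr.
    by apply: (cvg_unique _ lim) => //; exact: cvg_cst.
  apply/funext => N /=; rewrite addn3 addn2 addn1 addn0.
  exact: partial_sum_identity.
apply: cvgD; [apply: cvgD; [apply: cvgB|]|].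
- exact: cP.
- apply: cvg_big => [|x _]; first exact: add_continuous.
  by apply: cvgM; [exact: cvg_cst | exact: cP].
- by apply: cvgM; [exact: cvg_cst | exact: cP].
- apply: cvg_big => [|x _]; first exact: add_continuous.
  by apply: cvgM; [exact: cvg_cst | exact: cP].
Qed.
End GeneratingFunction.

(** * Convergence and eigenvalues *)

Section Radius.
Local Open Scope classical_set_scope.
Local Open Scope ring_scope.
Variables (R : realType) (n : nat) (E : rel 'I_n).
Local Notation p := (pk R E).
Local Notation M := (deformed_laplacian R E).
Local Notation nbconv := (nbconv E).

(** Cramer's rule, with both factors other than [nbgen] polynomial in [t]. *)
Lemma nbconv_det (t : R) i j : nbconv t ->
  (\det M).[t] * nbgen E t i j = (1 - t ^+ 2) * (\adj M i j).[t].
Proof.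
move=> ct; have := congr1 (mulmx (\adj (map_mx (horner_eval t) M)))
  (deformed_laplacian_nbgen ct).
rewrite mulmxA mul_adj_mx -map_mx_adj det_map_mx mul_mx_scalar mul_scalar_mx.
by move/matrixP/(_ i j); rewrite mxE [RHS]mxE [in RHS]mxE.
Qed.

(** By [deformed_laplacian_nbgen], the determinant of [M] at [t] divides a power of [1 - t ^+ 2],
    which is nonzero. *)
Lemma nbconv_not_eigenvalue (t : R) : 0 <= t -> t != 1 -> nbconv t ->
  ~~ finite_eigenvalue E t.
Proof.
move=> t0 t1 ct; apply/negP => /rootP dt.
have := congr1 determinant (deformed_laplacian_nbgen ct).
rewrite det_mulmx det_map_mx /= /horner_eval dt mul0r det_scalar => /esym/eqP.
rewrite expf_eq0 subr_eq0 => /andP[_ /eqP]; rewrite expr2 => e.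
have : (1 - t) * (1 + t) == 0.
  by apply/eqP; transitivity (1 - t * t); [ring | rewrite -e subrr].
rewrite mulf_eq0 subr_eq0 eq_sym (negbTE t1) /= gt_eqF //.
by rewrite ltr_pwDl.
Qed.

(** At [1] the matrix is [D - S], whose rows sum to zero, so it annihilates the nonzero constant
    vector. *)
Lemma eigenvalue1 : (0 < n)%N -> finite_eigenvalue (R := R) E 1.
Proof.
move=> n0; apply/rootP.
pose M1 := map_mx (horner_eval 1) M; pose c : 'cV[R]_n := const_mx 1.
have M1c : M1 *m c = 0.
  apply/matrixP => i j; rewrite mxE [RHS]mxE.
  transitivity (\sum_x (degD R E i x - symp R E i x)).
    apply: eq_bigr => x _; rewrite [M1 _ _]mxE [c _ _]mxE /horner_eval.
    by rewrite deformed_laplacian_horner !expr1n; ring.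
  rewrite sumrB (bigD1 i) //= [X in _ + X - _]big1 => [|x xi]; last first.
    by rewrite mxE eq_sym (negbTE xi) mul0r.
  rewrite addr0 mxE eqxx mul1r [(adj R E *m adj R E) i i]mxE -sumrB big1 // => x _.
  by rewrite [symp _ _ _ _]mxE subrr.
have := congr1 (mulmx (\adj M1)) M1c.
rewrite mulmxA mul_adj_mx mulmx0 mul_scalar_mx => /matrixP/(_ (Ordinal n0) 0).
by rewrite !mxE mulr1 /M1 det_map_mx.
Qed.

Lemma pterm_ge0 (t : R) i j k : 0 <= t -> 0 <= pterm E t i j k.
Proof. by move=> t0; rewrite /pterm mxE mulr_ge0 ?ler0n ?exprn_ge0. Qed.

Lemma nbconv_le (s t : R) : 0 <= s -> s <= t -> nbconv t -> nbconv s.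
Proof.
move=> s0 st ct i j; have t0 := le_trans s0 st.
apply: series_le_cvg (ct i j) => k; rewrite ?pterm_ge0 //.
by rewrite ler_wpM2l ?mxE ?ler0n // lerXn2r.
Qed.

(** Abel's lemma: terms bounded at [t] are dominated at [s] by a geometric series of ratio
    [s / t]. *)
Lemma nbconv_bounded (s t C : R) : 0 <= s -> s < t ->
  (forall k i j, pterm E t i j k <= C) -> nbconv s.
Proof.
move=> s0 st hC i j; have t0 := le_lt_trans s0 st.
have C0 : 0 <= C by apply: le_trans (hC 0%N i j); rewrite pterm_ge0 // ltW.
have g0 : 0 <= s / t by rewrite divr_ge0 // ltW.
apply: (@series_le_cvg _ _ (geometric C (s / t))) => [k|k|k|].
- by rewrite pterm_ge0.
- by rewrite /= mulr_ge0 // exprn_ge0.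
- rewrite /= [X in X <= _](_ : _ = pterm E t i j k * (s / t) ^+ k).
    by rewrite ler_wpM2r // exprn_ge0.
  by rewrite /pterm expr_div_n -mulrA [t ^+ k * _]mulrC divfK // expf_neq0 // gt_eqF.
- by apply: is_cvg_geometric_series; rewrite ger0_norm // ltr_pdivrMr // mul1r.
Qed.

Let q k : R := \sum_i \sum_j p k i j.

Local Lemma q_ge0 k : 0 <= q k.
Proof. by apply: sumr_ge0 => i _; apply: sumr_ge0 => j _; rewrite mxE ler0n. Qed.

Local Lemma pk_le_q k i j : p k i j <= q k.
Proof.
have p0 a b : 0 <= p k a b by rewrite mxE ler0n.
rewrite /q (bigD1 i) //= (bigD1 j) //= -addrA lerDl addr_ge0 ?sumr_ge0 // => a _.
exact: sumr_ge0.
Qed.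

Local Lemma q_submul k l : q (k + l) <= q k * q l.
Proof.
have p0 m a b : 0 <= p m a b by rewrite mxE ler0n.
rewrite /q mulr_suml; apply: ler_sum => i _; rewrite mulr_suml.
apply: (@le_trans _ _ (\sum_j \sum_x p k i x * p l x j)).
  apply: ler_sum => j _; rewrite mxE.
  apply: (@le_trans _ _ (\sum_x nbtw_count E k i x * nbtw_count E l x j)%N%:R).
    by rewrite ler_nat nbtw_count_submul.
  by rewrite natr_sum; apply: ler_sum => x _; rewrite natrM !mxE.
rewrite exchange_big /=; apply: ler_sum => x _.
rewrite -mulr_sumr ler_wpM2l // [leRHS](bigD1 x) //= lerDl.
by apply: sumr_ge0 => a _; apply: sumr_ge0.
Qed.

(** Write [k] as [a * m + b] with [b < m]: by submultiplicativity each of the [a] blocks contributes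
    a factor at most one. *)
Local Lemma q_bounded m (t : R) : (0 < m)%N -> 0 <= t -> q m * t ^+ m <= 1 ->
  forall k i j, pterm E t i j k <= \sum_(b < m) q b * t ^+ b.
Proof.
move=> m0 t0 qm k i j.
apply: (@le_trans _ _ (q k * t ^+ k)); first by rewrite ler_wpM2r ?exprn_ge0 ?pk_le_q.
have qt0 l : 0 <= q l * t ^+ l by rewrite mulr_ge0 ?q_ge0 ?exprn_ge0.
have red a b : q (a * m + b)%N * t ^+ (a * m + b) <= q b * t ^+ b.
  elim: a => [|a IHa]; first by rewrite mul0n add0n.
  rewrite mulSn -addnA exprD; apply: le_trans IHa.
  apply: (@le_trans _ _ ((q m * t ^+ m) * (q (a * m + b)%N * t ^+ (a * m + b)))).
    rewrite mulrACA ler_wpM2r ?q_submul //.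
    by rewrite mulr_ge0 ?exprn_ge0.
  by rewrite ler_piMl.
rewrite {1 2}(divn_eq k m); apply: le_trans (red _ _) _.
rewrite (bigD1 (Ordinal (ltn_pmod k m0))) //= lerDl.
by apply: sumr_ge0.
Qed.

Lemma nbconv_pterm_small (t e : R) : 0 < e -> nbconv t -> exists K, forall k i j,
  (K <= k)%N -> pterm E t i j k < e.
Proof.
move=> e0 ct.
have ev i j : \forall k \near \oo, pterm E t i j k < e.
  have /cvgr0Pnorm_lt/(_ e e0) := cvg_series_cvg_0 (ct i j).
  by apply: filterS => k; apply: le_lt_trans; exact: ler_norm.
have evall : \forall k \near \oo, forall i j, pterm E t i j k < e.
  by apply: filter_forall => i; apply: filter_forall => j.
by case: evall => K _ hK; exists K => k i j Kk; apply: hK.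
Qed.

(* Submultiplicativity makes the set of convergence open to the right. *)
Lemma nbconv_open (t : R) : 0 <= t -> nbconv t -> exists2 t', t < t' & nbconv t'.
Proof.
move=> t0 ct.
have [m m0 qm] : exists2 m, (0 < m)%N & q m * t ^+ m < 1.
  (* The [n * n] entries, each below this bound, have sum below one. *)
  have e0 : 0 < (n * n).+1%:R^-1 :> R by rewrite invr_gt0 ltr0n.
  have [K hK] := nbconv_pterm_small e0 ct; exists K.+1 => //.
  apply: (@le_lt_trans _ _ (\sum_(i < n) \sum_(j < n) (n * n).+1%:R^-1)).
    rewrite mulr_suml; apply: ler_sum => i _; rewrite mulr_suml.
    by apply: ler_sum => j _; apply/ltW/hK.
  rewrite !sumr_const !card_ord -mulrnA -[X in X < _]mulr_natr mulrC.
  by rewrite ltr_pdivrMr ?ltr0n // mul1r ltr_nat.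
have e0 : 0 < 1 - q m * t ^+ m by rewrite subr_gt0.
(* By continuity the value is still at most one at [t + d / 2], where the terms are thus bounded;
   convergence follows at the smaller point [t + d / 4]. *)
have [d d0 hd] := polyrcf.poly_cont t (q m *: 'X^m) e0.
exists (t + d / 4); first by rewrite ltrDl divr_gt0.
have [d4 d2] : d / 4 < d / 2 /\ d / 2 < d by split; lra.
apply: (@nbconv_bounded _ (t + d / 2)); [lra|lra|apply: (q_bounded m0)]; first lra.
have := hd (t + d / 2); rewrite addrAC subrr add0r gtr0_norm ?divr_gt0 //.
move=> /(_ d2); rewrite !hornerE => /ltr_normlP[_].
by rewrite ltrBrDr subrK => /ltW.
Qed.

Lemma poly_nonneg_closure (g : {poly R}) r : 0 < r ->
  (forall t : R, 0 < t -> t < r -> 0 <= g.[t]) -> 0 <= g.[r].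
Proof.
move=> r0 hg; rewrite leNgt; apply/negP => gr.
have e0 : 0 < - g.[r] by rewrite oppr_gt0.
have [d d0 hd] := polyrcf.poly_cont r g e0.
(* This point is positive, below [r] and within [d] of it. *)
pose t := r - Num.min d r / 2.
have m0 : 0 < Num.min d r by rewrite lt_min d0.
have [md mr] : Num.min d r <= d /\ Num.min d r <= r by rewrite !ge_min !lexx orbT.
have tr : `|t - r| < d by rewrite /t addrAC subrr add0r normrN gtr0_norm; lra.
have gt0 : 0 <= g.[t] by apply: hg; rewrite /t; lra.
by have /ltr_normlP[_ h] := hd t tr; lra.
Qed.

(* Before [r] the partial sums satisfy [|det M(t)| P_N(t) <= |(1 - t^2) adj M(t)|];
   both sides are polynomial in [t], so this persists at [r] and bounds [P_N(r)]. *)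
Lemma nbconv_closed (r : R) : 0 < r -> (forall t : R, 0 <= t -> t < r -> nbconv t) ->
  ~~ finite_eigenvalue E r -> nbconv r.
Proof.
move=> r0 cr dr i j.
pose d : {poly R} := \det M; pose a : {poly R} := (1 - 'X^2) * \adj M i j.
pose P N : {poly R} := \sum_(k < N) p k i j *: 'X^k.
have PE N t : (P N).[t] = series (pterm E t i j) N.
  rewrite /P horner_sum seriesEord; apply: eq_bigr => k _.
  by rewrite !hornerE.
have ad (t : R) : nbconv t -> a.[t] = d.[t] * nbgen E t i j.
  by move=> ct; rewrite nbconv_det // /a !hornerE.
have dr0 : 0 < `|d.[r]| by rewrite normr_gt0.
have nd (t : R) : 0 <= t -> nondecreasing_seq (series (pterm E t i j)).
  move=> t0; apply/nondecreasing_seqP => k; rewrite !seriesEnat /= big_nat_recr //=.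
  by rewrite lerDl; exact: pterm_ge0.
have P0 N (t : R) : 0 <= t -> 0 <= (P N).[t].
  by move=> t0; rewrite PE seriesEord; apply: sumr_ge0 => k _; apply: pterm_ge0.
clearbody a d P.
(* Squares replace absolute values to keep the inequality polynomial. *)
have le N : 0 <= (a * a - (d * P N) * (d * P N)).[r].
  apply: poly_nonneg_closure => // t t0 tr; have ct := cr t (ltW t0) tr.
  rewrite hornerD hornerN !hornerM subr_ge0 ad // -!expr2 !exprMn.
  rewrite ler_wpM2l ?sqr_ge0 // lerXn2r ?nnegrE ?P0 ?(ltW t0) //.
    rewrite mxE; apply: le_trans (nondecreasing_cvgn_le (nd _ (ltW t0)) (ct i j) 0%N).
    by rewrite -PE P0 // ltW.
  rewrite PE mxE; exact: (nondecreasing_cvgn_le (nd _ (ltW t0)) (ct i j)).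
apply: nondecreasing_is_cvgn; first by apply: nd; rewrite ltW.
exists (`|a.[r]| / `|d.[r]|) => _ [N _ <-]; rewrite -PE ler_pdivlMr //.
rewrite -(ger0_norm (P0 N r (ltW r0))) -normrM -ler_sqr ?nnegrE ?normr_ge0 //.
rewrite !real_normK ?num_real // exprMn mulrC.
by have := le N; rewrite hornerD hornerN !hornerM subr_ge0 -!expr2 exprMn.
Qed.

Lemma nbconv_vanish m (t : R) : (0 < m)%N -> 0 <= t ->
  (forall i j, nbtw_count E m i j = 0%N) -> nbconv t.
Proof.
move=> m0 t0 pm0; have t1 : t < t + 1 by rewrite ltrDl.
apply: (nbconv_bounded t0 t1 (q_bounded m0 _ _)); first by rewrite addr_ge0.
rewrite /q big1 ?mul0r // => i _; rewrite big1 // => j _.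
by rewrite mxE pm0.
Qed.

Lemma nbconv0 : nbconv (0 : R).
Proof.
have q1 : 0 < q 1 + 1 by rewrite ltr_wpDl ?q_ge0.
have t0 : 0 < (q 1 + 1)^-1 by rewrite invr_gt0.
apply: (nbconv_bounded (lexx _) t0 (q_bounded (ltn0Sn 0) (ltW t0) _)).
by rewrite expr1 ler_pdivrMr // mul1r lerDl.
Qed.

End Radius.

(** * The radius of convergence and the three cases *)

Section Trichotomy.
Local Open Scope classical_set_scope.
Local Open Scope ring_scope.
Variables (R : realType) (n : nat) (E : rel 'I_n).

Lemma nbconv_unbranched (s : R) : 0 <= s -> s < 1 -> ~ nbbranching E -> nbconv E s.
Proof.
move=> s0 s1 nobr; pose t := (1 + s) / 2.
have [st t1] : s < t /\ t < 1 by rewrite /t; split; lra.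
have t0 : 0 <= t by rewrite /t; lra.
(* With [A] above [n * n / (1 - t)], the rate [1 + n * n / A] times [t] is at most one. *)
clearbody t; pose A := Num.bound ((n * n)%:R / (1 - t)).
have x0 : 0 <= (n * n)%:R / (1 - t) by rewrite divr_ge0 ?ler0n // subr_ge0 ltW.
have hA : (n * n)%:R / (1 - t) < A%:R := archi_boundP x0.
have A0 : (0 < A)%N by rewrite -(ltr0n R) (le_lt_trans x0).
have hAt : (A + n * n)%:R * t <= A%:R.
  move: hA; rewrite ltr_pdivrMr ?subr_gt0 // natrD => hA.
  have : (n * n)%:R * t <= (n * n)%:R by rewrite ler_piMr ?ler0n ?ltW.
  lra.
pose C := (n * A ^ (n * n))%N.
(* The summand [1] covers [k = 0]. *)
apply: (@nbconv_bounded _ _ _ _ t (1 + C%:R)) => // k i j.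
case: k => [|k].
  rewrite /pterm mxE nbtw_count0 expr0 mulr1.
  by rewrite (@le_trans _ _ 1) ?lerDl ?ler0n // lern1 leq_b1.
rewrite (@le_trans _ _ C%:R) ?lerDr // /pterm mxE.
have Ak : 0 < (A ^ k)%:R :> R by rewrite ltr0n expn_gt0 A0.
rewrite -(ler_pM2r Ak) exprS mulrCA -mulrA.
apply: (@le_trans _ _ ((nbtw_count E k.+1 i j)%:R * t ^+ k * (A ^ k)%:R)).
  apply: ler_piMl (ltW t1); apply: mulr_ge0 (ltW Ak).
  by rewrite mulr_ge0 ?ler0n ?exprn_ge0.
rewrite mulrAC -natrM.
apply: (@le_trans _ _ ((C * (A + n * n) ^ k)%N%:R * t ^+ k)).
  by rewrite ler_wpM2r ?exprn_ge0 // ler_nat unbranched_count_le.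
rewrite natrM -mulrA ler_wpM2l ?ler0n // natrX -exprMn natrX.
by apply: lerXn2r; rewrite ?nnegrE ?mulr_ge0 ?ler0n.
Qed.

Lemma nbrecurrent_dvg e : nbrecurrent E e -> ~ nbconv E (1 : R).
Proof.
move=> /nbrecurrent_count[L [i [j [L0 hL]]]] c1.
have [K hK] := nbconv_pterm_small ltr01 c1.
have KL : (K <= (K * L).+1)%N by rewrite ltnW // ltnS leq_pmulr.
have := hK _ i j KL; rewrite /pterm expr1n mulr1 mxE ltrn1.
by have := hL K; case: nbtw_count.
Qed.

(** Choose [t] below one with [t] and [t ^+ L] at least one half. The term of index [m * L + 1] is
    then at least [2 ^ m * t ^ (m * L) * t], hence at least one half. *)
Lemma nbbranching_dvg : nbbranching E -> exists2 t : R, 0 <= t < 1 & ~ nbconv E t.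
Proof.
move=> /nbbranching_count[L [i [j [L0 hL]]]].
have h0 : 0 < 2^-1 :> R by rewrite invr_gt0.
have [d d0 hd] := polyrcf.poly_cont 1 ('X^L : {poly R}) h0.
pose t := 1 - Num.min d 1 / 2.
have m0 : 0 < Num.min d 1 by rewrite lt_min d0 ltr01.
have [md m1] : Num.min d 1 <= d /\ Num.min d 1 <= 1 by rewrite !ge_min !lexx orbT.
have [t2 t1] : 2^-1 <= t /\ t < 1 by rewrite /t; split; lra.
have t0 : 0 <= t by lra.
have td : `|t - 1| < d by rewrite /t addrAC subrr add0r normrN gtr0_norm; lra.
have tL : 2^-1 <= t ^+ L.
  by have := hd t td; rewrite !hornerXn expr1n => /ltr_normlP[h _]; lra.
clearbody t; exists t; first by rewrite t0.
move=> ct; have [K hK] := nbconv_pterm_small h0 ct.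
have KL : (K <= (K * L).+1)%N by rewrite ltnW // ltnS leq_pmulr.
have := hK _ i j KL; apply/negP; rewrite -leNgt /pterm mxE exprS mulrCA.
apply: le_trans t2 _; rewrite ler_peMr // mulnC exprM.
apply: (@le_trans _ _ (2 ^+ K * (2^-1) ^+ K)).
  by rewrite -exprMn divff // expr1n.
have h0k : 0 <= 2^-1 ^+ K :> R by rewrite exprn_ge0 // ltW.
apply: ler_pM => //.
  by rewrite -natrX ler_nat mulnC hL.
by apply: lerXn2r; rewrite ?nnegrE ?exprn_ge0 // ltW.
Qed.

Definition nbconv_set : set R := [set t | 0 <= t /\ nbconv E t].

Lemma nbtw_radiusE : nbtw_radius R E = ereal_sup (EFin @` nbconv_set).
Proof. by []. Qed.

Lemma nbtw_radius_infinite : (forall t : R, 0 <= t -> nbconv E t) ->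
  nbtw_radius R E = +oo%E.
Proof.
move=> call; apply: eq_infty => r; rewrite nbtw_radiusE.
apply: (@le_trans _ _ (Num.max r 0)%:E); first by rewrite lee_fin le_max lexx.
apply: ereal_sup_ubound; exists (Num.max r 0) => //.
have m0 : 0 <= Num.max r 0 by rewrite le_max lexx orbT.
by split=> //; exact: call.
Qed.

(** The convergence set is downward closed and open to the right, so it omits its supremum [r]. If
    [r] were not an eigenvalue, [nbconv_closed] would put it in the set. *)
Lemma nbtw_radius_finite (t : R) : 0 <= t -> ~ nbconv E t ->
  exists r : R, [/\ 0 < r <= t, nbtw_radius R E = r%:E,
    forall s : R, 0 <= s -> nbconv E s <-> s < r & finite_eigenvalue E r].
Proof.
move=> t0 nct.
have ub : ubound nbconv_set t.
  move=> s [s0 cs]; rewrite leNgt; apply/negP => ts; apply: nct.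
  exact: nbconv_le t0 (ltW ts) cs.
have S0 : nbconv_set 0 by split=> //; exact: nbconv0.
have hs : has_sup nbconv_set by split; [exists 0 | exists t].
pose r := sup nbconv_set.
have below s : 0 <= s -> s < r -> nbconv E s.
  move=> s0 sr; have rs0 : 0 < r - s by rewrite subr_gt0.
  have [s' [s'0 cs']] := sup_adherent rs0 hs.
  by rewrite subKr => ss'; apply: nbconv_le s0 (ltW ss') cs'.
have inS s : 0 <= s -> nbconv E s -> s < r.
  move=> s0 /(nbconv_open s0)[s' ss' cs']; apply: (lt_le_trans ss').
  apply: ub_le_sup; first by exists t.
  by split=> //; rewrite (le_trans s0) // ltW.
have r0 : 0 < r by apply: inS => //; exact: nbconv0.
exists r; split.
- by rewrite r0 /=; apply: ge_sup => //; exists 0.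
- by rewrite nbtw_radiusE ereal_sup_EFin //; [exists t | exists 0].
- by move=> s s0; split; [exact: inS | exact: below].
apply/negPn/negP => /(nbconv_closed r0 below) /(inS r (ltW r0)).
by rewrite ltxx.
Qed.

End Trichotomy.

Theorem theorem3p13 (R : realType) (n : nat) (E : rel 'I_n)
  (noloop : irreflexive E) (mu : R) :
  0 < mu -> finite_eigenvalue E mu ->
  (forall t : R, 0 < t -> finite_eigenvalue E t -> mu <= t) ->
  [/\ (forall x : 'I_n, is_tree_on E (scomp E x) \/ isolated_node_on (scomp E x)) ->
        mu = 1 /\ (1%:E < nbtw_radius R E)%E /\ nbtw_radius R E = +oo%E,
      (forall x : 'I_n, at_most_one_cycle E (scomp E x)) ->
      (exists x : 'I_n, exactly_one_cycle E (scomp E x)) ->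
        mu = 1 /\ nbtw_radius R E = 1%:E
    & (exists x : 'I_n, more_than_one_cycle E (scomp E x)) ->
        mu < 1 /\ nbtw_radius R E = mu%:E].
Proof.
move=> mu0 emu mumin.
(* The empty determinant is one and has no root. *)
have n0 : (0 < n)%N.
  case: n E emu {noloop mumin} => // E0; rewrite /finite_eigenvalue det_mx00.
  by rewrite rootC oner_eq0.
have mu1 : mu <= 1 by apply: mumin => //; exact: eigenvalue1.
have mu_eq1 : (forall t : R, 0 <= t -> t < 1 -> nbconv E t) -> mu = 1.
  move=> below; apply/eqP; rewrite eq_le mu1 leNgt; apply/negP => lt1.
  have := nbconv_not_eigenvalue (ltW mu0) (negbT (lt_eqF lt1)) (below mu (ltW mu0) lt1).
  by rewrite emu.
split.
- move=> tree.
  have call (t : R) : 0 <= t -> nbconv E t.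
    move=> t0; apply: (@nbconv_vanish _ _ _ n) => // i j.
    by apply: acyclic_count_eq0 => // x; apply: tree_or_isolated_acyclic.
  rewrite (nbtw_radius_infinite call) ltry; split=> //.
  by apply: mu_eq1 => t t0 _; exact: call.
- move=> amo [x [[s us] _]].
  have nobr := at_most_one_cycle_nobranching noloop amo.
  have below (t : R) : 0 <= t -> t < 1 -> nbconv E t.
    by move=> t0 t1; apply: nbconv_unbranched.
  split; first exact: mu_eq1.
  have [[e rec] _] := ucycles_branching noloop us us.
  have [r [/andP[r0 r1] -> rP _]] := nbtw_radius_finite ler01 (nbrecurrent_dvg (R := R) rec).
  congr EFin; apply/eqP; rewrite eq_le r1 leNgt; apply/negP => lt1.
  by have /rP := below r (ltW r0) lt1; rewrite ltxx => /(_ (ltW r0)).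
move=> [x [s [t [us ut nst]]]].
have [_ [br|//]] := ucycles_branching noloop us ut.
have [t0 /andP[t00 t01] nct0] := nbbranching_dvg R br.
(* The radius [r] is an eigenvalue at most [t0], so [mu <= r < 1]; and [mu < r] would mean
   convergence at the eigenvalue [mu]. *)
have [r [/andP[r0 rt] -> rP er]] := nbtw_radius_finite t00 nct0.
have mur : mu <= r := mumin r r0 er.
have lt1 : mu < 1 by lra.
split=> //; congr EFin; apply/eqP; rewrite eq_le mur andbT leNgt; apply/negP => lt.
have cmu : nbconv E mu by apply/rP => //; exact: ltW.
by have := nbconv_not_eigenvalue (ltW mu0) (negbT (lt_eqF lt1)) cmu; rewrite emu.
Qed.
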